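(* For each $d\ge5$ there is an estimator $\Gamma$ (on $\mathbb{Z}^d$) such that $$I_d:=\inf_{v\in\mathbb{Z}^d}\mathbb{P}_v\big(\Gamma(G_\infty^d)=v\big)$$ satisfies $I_d>0$ for every $d\ge5$, and $I_d=1-O(1/d)$ as $d\to\infty$ (that is, there exist constants $C>0$ and $d_0$ with $I_d\ge 1-C/d$ for all $d\ge d_0$). Furthermore, for any estimator $\Phi$, $\inf_{v\in\mathbb{Z}^d}\mathbb{P}_v(\Phi(G_\infty^d)=v)=1-\Omega(1/d)$ as $d\to\infty$ (that is, there exist constants $c>0$ and $d_0$ such that for all $d\ge d_0$ and every estimator $\Phi$ on $\mathbb{Z}^d$ this infimum is at most $1-c/d$).
   Context: $(X_n)_{n\ge0}$ is the simple random walk on the nearest-neighbour lattice $\mathbb{Z}^d$; $\mathbb{P}_v$ is its law when started at the source $X_0=v$. $G_\infty^d$ is the total (infinite) trace: the subgraph of $\mathbb{Z}^d$ with vertex set $\{X_n:n\ge0\}$ and edge set $\{\{X_n,X_{n+1}\}:n\ge0\}$ (as an embedded graph, i.e. its actual vertex and edge sets in $\mathbb{Z}^d$ are known). An estimator is a (measurable) function taking as input an embedded graph $G\subseteq\mathbb{Z}^d$ and outputting a vertex of $\mathbb{Z}^d$; the output may be random, conditionally on the trace (i.e. given $G$ it is drawn from a distribution depending only, measurably, on $G$, independently of the walk otherwise). Estimators need not be translation invariant. *)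

(* Defs.v *)
From HB Require Import structures.
From mathcomp Require Import all_boot all_order all_algebra.
From mathcomp Require Import all_classical all_reals all_analysis.

Set Implicit Arguments.
Unset Strict Implicit.
Unset Printing Implicit Defensive.

Import Order.TTheory GRing.Theory Num.Theory.

Local Open Scope classical_set_scope.
Local Open Scope ring_scope.

(* The points of Z^d, with the discrete sigma-algebra (Z^d is countable). *)
Definition lattice (d : nat) : Type := 'rV[int]_d.

HB.instance Definition _ (d : nat) := GRing.Zmodule.on (lattice d).
HB.instance Definition _ (d : nat) := isPointed.Build (lattice d) 0.
HB.instance Definition _ (d : nat) :=
  @isMeasurable.Build default_measure_display (lattice d)
    discrete_measurable discrete_measurable0
    discrete_measurableC discrete_measurableU.

Definition lattice_adj (d : nat) (x y : lattice d) : bool :=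
  \sum_(i < d) `|x ord0 i - y ord0 i| == 1.

(* Subgraphs of the nearest-neighbour lattice. An edge is the unordered pair
   [set x; y] of its endpoints. *)
Record subgraph (d : nat) : Type := Subgraph {
  vertices : set (lattice d);
  edges : set (set (lattice d));
  edgesP : forall e, edges e -> exists x y : lattice d,
    [/\ lattice_adj x y, vertices x, vertices y & e = [set x; y]] }.

HB.instance Definition _ (d : nat) := gen_eqMixin (subgraph d).
HB.instance Definition _ (d : nat) := gen_choiceMixin (subgraph d).

Definition empty_subgraph (d : nat) : subgraph d :=
  @Subgraph d set0 set0 (fun e => @False_ind _).

HB.instance Definition _ (d : nat) :=
  isPointed.Build (subgraph d) (empty_subgraph d).

(* The sigma-algebra on subgraphs is the one generated by the presence of each
   vertex and of each edge, i.e. the product sigma-algebra on the indicators. *)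
Definition subgraph_events (d : nat) : set (set (subgraph d)) :=
  [set A | (exists x : lattice d, A = [set G | vertices G x]) \/
           (exists x y : lattice d, A = [set G | edges G [set x; y]])].

Definition graph_space (d : nat) : measurableType _ :=
  g_sigma_algebraType (@subgraph_events d).

(* Trajectories in Z^d, with the sigma-algebra generated by the coordinates. *)
Definition coordinate_events (d : nat) : set (set (nat -> lattice d)) :=
  [set A | exists (n : nat) (x : lattice d), A = [set w | w n = x]].

Definition trajectory (d : nat) : measurableType _ :=
  g_sigma_algebraType (@coordinate_events d).

(* P is the law of the simple random walk on Z^d started at v: the
   finite-dimensional distributions
     P(X_0 = x_0, ..., X_n = x_n)
   are 1/(2d)^n if x_0 = v and x_0, ..., x_n is a nearest-neighbour path, and 0
   otherwise. *)
Definition is_srw_law (R : realType) (d : nat) (v : lattice d)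
    (P : probability (trajectory d) R) : Prop :=
  forall (n : nat) (x : nat -> lattice d),
    P [set w : trajectory d | forall i, (i <= n)%N -> w i = x i] =
    (if (x 0%N == v) && [forall i : 'I_n, lattice_adj (x i) (x i.+1)]
     then ((2 * d)%:R ^- n)%:E else 0%E).

(* The trace is defined for an arbitrary sequence of points, so only the pairs
   {w_n, w_(n+1)} that are lattice edges are kept: under the law of the simple
   random walk these are almost surely all of them. *)
Definition trace_edges (d : nat) (w : nat -> lattice d) :
    set (set (lattice d)) :=
  [set e | exists n : nat, lattice_adj (w n) (w n.+1) /\ e = [set w n; w n.+1]].

Lemma trace_edgesP (d : nat) (w : nat -> lattice d) (e : set (lattice d)) :
  trace_edges w e -> exists x y : lattice d,
    [/\ lattice_adj x y, range w x, range w y & e = [set x; y]].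
Proof.
move=> [n [wn ->]]; exists (w n), (w n.+1).
by split.
Qed.

Definition walk_trace (d : nat) (w : trajectory d) : graph_space d :=
  Subgraph (@trace_edgesP d w).

Lemma measurable_coordinate (d : nat) (n : nat) (x : lattice d) :
  measurable ([set w | w n = x] : set (trajectory d)).
Proof. by apply: sub_gen_smallest; exists n, x. Qed.

Lemma measurable_walk_trace (d : nat) : measurable_fun setT (@walk_trace d).
Proof.
apply: (@measurability _ _ (trajectory d) (graph_space d) setT (@walk_trace d)
  (@subgraph_events d)) => //.
move=> _ [_ [[x ->]|[x [y ->]]] <-]; rewrite setTI.
- rewrite (_ : _ @^-1` _ = \bigcup_n [set w : trajectory d | w n = x]).
    by apply: bigcup_measurable => n _; exact: measurable_coordinate.
  by apply/seteqP; split=> [w [n _ <-]|w [n _ /= <-]]; exists n.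
- pose Q (p : 'rV[int]_d * 'rV[int]_d) :=
    @lattice_adj d p.1 p.2 /\ [set x; y] = [set p.1; p.2].
  rewrite (_ : _ @^-1` _ = \bigcup_n \bigcup_p
    [set w : trajectory d | Q p /\ (w n = p.1 /\ w n.+1 = p.2)]); last first.
    apply/seteqP; split=> [w [n Qn]|w [n _ [p _ /= [Qp [wn wn1]]]]].
      by exists n => //; exists (w n, w n.+1).
    by exists n; rewrite wn wn1.
  apply: bigcup_measurable => n _.
  apply: countable_bigcupT_measurable => [|p]; first exact: countableP.
  have [Qp|nQp] := pselect (Q p); last first.
    by rewrite (_ : mkset _ = set0) //; apply/seteqP; split=> // w [].
  rewrite (_ : mkset _ = [set w : trajectory d | w n = p.1] `&`
                         [set w : trajectory d | w n.+1 = p.2]).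
    by apply: measurableI; exact: measurable_coordinate.
  by apply/seteqP; split=> [w [_ []]|w []].
Qed.

(* A possibly randomised estimator: a probability kernel from subgraphs of Z^d
   to Z^d. *)
Definition estimator (R : realType) (d : nat) : Type :=
  R.-pker (graph_space d) ~> (lattice d).

(* P(Gamma(trace) = v), when the trajectory has law P and, given its trace G,
   the output is drawn from the distribution Gamma G. *)
Definition success_prob (R : realType) (d : nat)
    (Gamma : estimator R d) (P : probability (trajectory d) R)
    (v : lattice d) : \bar R :=
  (\int[P]_w Gamma (walk_trace w) [set v])%E.

(* inf_v P_v(Gamma(trace) = v), where P v stands for P_v. *)
Definition worst_success_prob (R : realType) (d : nat)
    (Gamma : estimator R d) (P : lattice d -> probability (trajectory d) R) :
    \bar R :=
  ereal_inf (range (fun v : lattice d => success_prob Gamma (P v) v)).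

(* Main.v *)
From HB Require Import structures.
Require Import Defs.
From mathcomp Require Import all_boot all_order all_algebra.
From mathcomp Require Import all_classical all_reals all_analysis.
From mathcomp Require Import measurable_realfun.
From mathcomp Require Import ring lra zify.

Set Implicit Arguments.
Unset Strict Implicit.
Unset Printing Implicit Defensive.

Import Order.TTheory GRing.Theory Num.Theory.
Local Open Scope classical_set_scope.
Local Open Scope ring_scope.

(** Why the theorem is true.

    Existence of the estimator.  For a walk w started at v, call i a cut time
    when w(0..i) and w(i+1..) are disjoint.  The walk then crosses the edge
    from w(i) to w(i+1) once, and w(0..i) is a finite set of vertices, at most
    i+1 of them, that the trace leaves only through w(i+1): a pocket around v.
    When a positive proportion theta of the times up to every n are cut times,
    v has for every k at least k+1 pockets, with distinct exits, of size at most
    1 + k / theta.  This is a property of the trace and of v ([source_like]),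
    and the estimator picks a uniform vertex among those that have it.

    No other vertex is likely to qualify.  Suppose w(m) does, with m > 0.  As
    the times up to m contain many cut times, w(0..m) is too large to lie in a
    pocket of size 1 + k / theta as long as k < theta^2 m, so both the past and
    the future of time m cross the exits of that many pockets.  Hence past and
    future have at least theta^2 m coincidences ([source_like_meetings]).  The
    number of coincidences is stochastically at most the number I of meetings
    of two independent walks from one point, apart from their start, so the expected number of wrong
    candidates is at most the sum over m of P(I >= theta^2 m), that is at most
    E[I] / theta^2: a first moment suffices.

    It remains to produce cut times.  If 1 + E[I] <= B, where the left side is
    sum_n (n+1) p_n with p_n the return probability, then decomposing at the
    last coincidence of past and future shows that a given time is a cut time
    with probability at least 1/B ([cut_prob_ge]); the maximal ergodic
    inequality ([not_dense_cuts_prob]) turns this into a positive proportion of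
    cut times in all initial windows at once, with probability at least
    1/(2B-1) for theta = 1/(2B).  Since p_n is at most of order n^(-d/2), such
    a B exists when d >= 5, and B = 1 + O(1/d) is possible; the resulting bound
    [source_estimator_success] is then positive for every d >= 5 and
    1 - O(1/d).

    Optimality.  A walk started at v that begins v, u, v has the same trace as
    the walk u, v started at u with the same continuation.  This common law is
    charged 1/(4 d^2) by the walk from v and 1/(2d) by the walk from u, and on
    it the estimator cannot name both u and v.  Summing the failures over the
    edges of the cube {0,1}^d gives a failure probability of at least
    1/(4d+2) ([success_upper_bound]). *)

(** * Counting closed walks *)

Lemma le_of_eq (disp : Order.disp_t) (T : porderType disp) (x y : T) :
  x = y -> (x <= y)%O.
Proof. by move=> ->. Qed.

(** The number of walks of j steps on the line that end where they start. *)
Definition central (j : nat) : nat := if odd j then 0%N else 'C(j, j./2).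

(** The number of closed walks of n steps in dimension k, by the number j of
    steps along the last axis. *)
Fixpoint closed_walks (k n : nat) : nat :=
  if k is k'.+1 then
    (\sum_(j < n.+1) 'C(n, j) * central j * closed_walks k' (n - j))%N
  else (n == 0)%N.

Lemma central_binS (s : nat) :
  ('C(s.+1.*2, s.+1) * s.+1 = 2 * (s.*2.+1) * 'C(s.*2, s))%N.
Proof.
have h1 : (s.+1 * 'C(s.+1.*2, s.+1) = s.+1.*2 * 'C(s.*2.+1, s))%N.
  by rewrite doubleS -mul_bin_diag.
have h2 : (s.*2.+1 * 'C(s.*2, s) = s.+1 * 'C(s.*2.+1, s))%N.
  have -> : s.+1 = (s.*2.+1 - s)%N by lia.
  by rewrite mul_bin_down.
nia.
Qed.

Lemma central_ratio (j : nat) : (central j.+2 <= 2 * j.+1 * central j)%N.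
Proof.
rewrite /central /= negbK; case: ifPn => // jev.
have hj : j = (j./2).*2 by rewrite even_halfK.
have := central_binS j./2; rewrite doubleS -hj.
move: 'C(j.+2, _) 'C(j, _) => a b; move: (j./2) hj => s; nia.
Qed.

Lemma central_sqr (j : nat) : (central j ^ 2 * j.+1 <= 4 ^ j)%N.
Proof.
rewrite /central; case: ifPn => jev; first by rewrite mul0n.
have hj : j = (j./2).*2 by rewrite even_halfK.
rewrite hj doubleK; move: (j./2) => {hj jev}s.
elim: s => [//|s IH].
have := central_binS s; rewrite doubleS !expnS.
move: IH; move: 'C(_, s.+1) 'C(_, s) => a b.
rewrite !expnS !expn0; move: (4 ^ _)%N => x.
move=> h1 h2.
rewrite -(@leq_pmul2r (s.+1 ^ 2)) //.
have -> : (a * (a * 1) * s.*2.+3 * s.+1 ^ 2 = (a * s.+1)^2 * s.*2.+3)%N by rewrite !expnS !expn0; nia.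
rewrite h2.
have -> : ((2 * s.*2.+1 * b) ^ 2 * s.*2.+3 = (4 * s.*2.+1 * s.*2.+3) * (b * (b * 1) * s.*2.+1))%N.
  by rewrite !expnS !expn0; nia.
have -> : (4 * (4 * x) * s.+1 ^ 2 = (4 * (4 * s.+1 ^2)) * x)%N by nia.
apply: leq_mul => //.
rewrite !expnS !expn0; nia.
Qed.

Lemma closed_walks1 (k : nat) : closed_walks k 1 = 0%N.
Proof.
elim: k => // k IH.
by rewrite /= big_ord_recr big_ord_recr big_ord0 /= subn0 IH muln0.
Qed.

(** A closed walk undoes its first step at one of its n + 1 later steps, and
    deleting both leaves a closed walk.  In the induction on the dimension this
    becomes a weighted count: multiplying by n + 2 = j + (n + 2 - j), where j is
    the number of steps along the last axis, lets the one-dimensional ratio act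
    on the first part and the induction hypothesis on the second. *)
Lemma closed_walks_ratio (k n : nat) :
  (closed_walks k n.+2 <= 2 * k * n.+1 * closed_walks k n)%N.
Proof.
elim: k n => [//|k IH] n.
rewrite -(@leq_pmul2l n.+2) //.
pose T1 := (\sum_(j < n.+3) (j * 'C(n.+2, j) * central j * closed_walks k (n.+2 - j)))%N.
pose T2 := (\sum_(j < n.+3) ((n.+2 - j) * 'C(n.+2, j) * central j * closed_walks k (n.+2 - j)))%N.
have -> : (n.+2 * closed_walks k.+1 n.+2 = T1 + T2)%N.
  rewrite /= big_distrr /= -big_split /=; apply: eq_bigr => j _.
  rewrite -[in X in (X * _)%N](@subnKC j n.+2); last by rewrite -ltnS.
  by rewrite !mulnDl; congr (_ + _)%N; rewrite !mulnA.
have H1 : (T1 <= n.+2 * (2 * n.+1) * closed_walks k.+1 n)%N.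
  rewrite /T1 big_ord_recl big_ord_recl !mul0n add0n.
  rewrite [central (lift _ _)]/central [odd _]/= muln0 mul0n add0n big_distrr /=; apply: leq_sum => j _.
  rewrite /bump /= !add1n !subSS !mulnA leq_mul2r; apply/orP; right.
  apply: leq_trans (leq_mul (leqnn _) (central_ratio j)) _.
  rewrite !mulnA leq_mul2r; apply/orP; right.
  have e1 : (n.+2 * 'C(n.+1, j.+1) = j.+2 * 'C(n.+2, j.+2))%N by rewrite mul_bin_diag.
  have e2 : (n.+1 * 'C(n, j) = j.+1 * 'C(n.+1, j.+1))%N by rewrite mul_bin_diag.
  apply: eq_leq; rewrite -e1.
  transitivity (2 * n.+2 * (j.+1 * 'C(n.+1, j.+1)))%N; first by nia.
  by rewrite -e2; nia.
have H2 : (T2 <= n.+2 * (2 * k * n.+1) * closed_walks k.+1 n)%N.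
  rewrite /T2 big_ord_recr /= subnn !mul0n addn0 big_ord_recr /=.
  have -> : closed_walks k (n.+2 - n.+1) = 0%N.
    by rewrite subSS subSnn closed_walks1.
  rewrite muln0 addn0 big_distrr /=; apply: leq_sum => j _.
  have jn : (j <= n)%N by rewrite -ltnS.
  rewrite subSn; last lia. rewrite subSn //.
  apply: leq_trans (leq_mul (leqnn _) (IH _)) _.
  rewrite !mulnA leq_mul2r; apply/orP; right.
  have e1 : (n.+2 * 'C(n.+1, j) = (n - j).+2 * 'C(n.+2, j))%N.
    by rewrite mul_bin_down; congr (_ * _)%N; lia.
  have e2 : (n.+1 * 'C(n, j) = (n - j).+1 * 'C(n.+1, j))%N.
    by rewrite mul_bin_down; congr (_ * _)%N; lia.
  apply: eq_leq; rewrite -e1.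
  transitivity (2 * k * n.+2 * central j * ((n-j).+1 * 'C(n.+1, j)))%N; first by nia.
  by rewrite -e2; nia.
apply: leq_trans (leq_add H1 H2) _.
by move: (closed_walks k.+1 n) => c; nia.
Qed.

Section RealBounds.
Variable R : realFieldType.

(** Cauchy-Schwarz with a free choice of the weights u. *)
Lemma sqr_sum_le (n : nat) (w x u : 'I_n -> R) :
  (forall i, 0 <= w i) -> (forall i, 0 < u i) -> 0 < \sum_i w i * u i ->
  (\sum_i w i * x i) ^+ 2 <= (\sum_i w i * u i) * \sum_i w i * (x i ^+ 2 / u i).
Proof.
move=> w0 u0 W0; set W := \sum_i w i * u i in W0 *; set X := \sum_i w i * x i.
rewrite -ler_pdivrMl //.
pose t := X / W.
have -> : W^-1 * X ^+ 2 = \sum_i w i * (2 * t * x i - t ^+ 2 * u i).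
  under eq_bigr => i _ do rewrite mulrBr [w i * (2 * t * _)]mulrCA [w i * (t ^+ 2 * _)]mulrCA.
  rewrite sumrB -!mulr_sumr -/X -/W /t; field; exact: lt0r_neq0.
apply: ler_sum => i _; apply: ler_wpM2l => //.
have ui := u0 i; rewrite ler_pdivlMr // -subr_ge0.
have -> : x i ^+ 2 - (2 * t * x i - t ^+ 2 * u i) * u i = (x i - t * u i) ^+ 2 by ring.
exact: sqr_ge0.
Qed.

(** Given the numbers N_i of steps along the axes, the walk is closed with
    probability a product of one-dimensional return probabilities, each at most
    (N_i + 1)^(-1/2).  Cauchy-Schwarz replaces the mean of that product by the
    mean of the product of the 1 / (N_i + 1), which for multinomial N_i is
    explicit: it amounts to distributing n + k + 1 steps, each axis being used. *)
Lemma closed_walks_sqr (k n : nat) :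
  (closed_walks k.+1 n)%:R ^+ 2 <=
    4 ^+ n * (k.+1%:R ^+ (n.*2 + k.+1) * (n`!%:R / (n + k.+1)`!%:R)) :> R.
Proof.
have cen j : (central j)%:R ^+ 2 <= 4 ^+ j / j.+1%:R :> R.
  rewrite ler_pdivlMr ?ltr0n // -!natrX -natrM ler_nat.
  exact: central_sqr.
elim: k n => [|k IH] n.
  rewrite /= (bigD1 ord_max) //= big1 ?addn0 => [|i /negbTE ni]; last first.
    rewrite subn_eq0 (_ : (n <= i)%N = false) ?muln0 //.
    apply/negbTE; rewrite -ltnNge ltn_neqAle -ltnS ltn_ord andbT.
    by apply/negP => /eqP e; move: ni; rewrite -val_eqE /= e eqxx.
  rewrite subnn binn mul1n muln1; apply: le_trans (cen n) _.
  apply: le_of_eq; rewrite expr1n mul1r addn1 factS natrM; field.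
  by rewrite nat1r !pnatr_eq0 -lt0n fact_gt0.
have kp : 0 < k.+1%:R :> R by rewrite ltr0n.
pose w (j : 'I_n.+1) : R := 'C(n, j)%:R * (2 ^+ j * 2 ^+ (n - j)).
have w2 (j : 'I_n.+1) : 2 ^+ j * 2 ^+ (n - j) = 2 ^+ n :> R.
  by rewrite -exprD subnKC // -ltnS.
pose x (j : 'I_n.+1) : R := ((central j)%:R / 2 ^+ j) * ((closed_walks k.+1 (n - j))%:R / 2 ^+ (n - j)).
pose u (j : 'I_n.+1) : R := k.+1%:R ^+ (n - j).
have Wsum : \sum_j w j * u j = 2 ^+ n * (k.+2%:R) ^+ n.
  rewrite -[k.+2%:R]natr1 (exprDn k.+1%:R) mulr_sumr; apply: eq_bigr => j _.
  by rewrite /w /u w2 expr1n mulr1 -mulr_natr; ring.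
have -> : (closed_walks k.+2 n)%:R = \sum_j w j * x j :> R.
  rewrite [closed_walks k.+2 n]/= natr_sum; apply: eq_bigr => j _.
  rewrite !natrM /w /x; field.
  by rewrite !expf_neq0.
apply: (le_trans (@sqr_sum_le _ w x u _ _ _)).
- by move=> j; rewrite !mulr_ge0 ?exprn_ge0 ?ler0n.
- by move=> j; rewrite /u exprn_gt0.
- by rewrite Wsum mulr_gt0 ?exprn_gt0 ?ltr0n.
have -> : 4 ^+ n = 2 ^+ n * 2 ^+ n :> R by rewrite -exprMn; congr (_ ^+ _); ring.
rewrite Wsum.
have -> : 2 ^+ n * 2 ^+ n * (k.+2%:R ^+ (n.*2 + k.+2) * (n`!%:R / (n + k.+2)`!%:R)) =
  2 ^+ n * k.+2%:R ^+ n * (2 ^+ n * k.+2%:R ^+ (n + k.+2) * (n`!%:R / (n + k.+2)`!%:R)) :> R.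
  by rewrite -addnn -addnA exprD; ring.
apply: ler_wpM2l; first by rewrite mulr_ge0 ?exprn_ge0 ?ler0n.
(* The terms b j are those of the binomial expansion of (k + 2)^(n + k + 2)
   with index j + 1; those of index 0 and above n + 1 are dropped. *)
pose b (j : 'I_n.+1) : R := 2 ^+ n * (n`!%:R / (n + k.+2)`!%:R) *
  (k.+1%:R ^+ (n - j + k.+1) * 'C(n + k.+2, j.+1)%:R).
apply: (@le_trans _ _ (\sum_j b j)); last first.
  rewrite -mulr_sumr [leRHS]mulrAC; apply: ler_wpM2l.
    by rewrite mulr_ge0 ?exprn_ge0 ?divr_ge0 ?ler0n.
  have -> : k.+2%:R ^+ (n + k.+2) =
      \sum_(0 <= i < (n + k.+2).+1) k.+1%:R ^+ (n + k.+2 - i) * 'C(n + k.+2, i)%:R :> R.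
    rewrite -[k.+2%:R]natr1 (exprDn k.+1%:R) big_mkord; apply: eq_bigr => i _.
    by rewrite expr1n mulr1 mulr_natr.
  have -> : \sum_(i < n.+1) k.+1%:R ^+ (n - i + k.+1) * 'C(n + k.+2, i.+1)%:R =
      \sum_(1 <= i < n.+2) k.+1%:R ^+ (n + k.+2 - i) * 'C(n + k.+2, i)%:R :> R.
    rewrite big_add1 /= big_mkord; apply: eq_bigr => i _.
    by congr (_ ^+ _ * _); have := ltn_ord i; lia.
  rewrite [leRHS](@big_cat_nat _ _ _ 1%N) //= [X in _ <= _ + X](@big_cat_nat _ _ _ n.+2) //=; last lia.
  rewrite addrCA lerDl addr_ge0 // sumr_ge0 // => i _; rewrite mulr_ge0 ?exprn_ge0 ?ler0n //.
apply: ler_sum => j _; have jn : (j <= n)%N by rewrite -ltnS.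
rewrite /w /x /u /b w2.
have e1 : (closed_walks k.+1 (n - j))%:R ^+ 2 / (2 ^+ (n - j)) ^+ 2 / k.+1%:R ^+ (n - j) <=
    k.+1%:R ^+ (n - j + k.+1) * ((n - j)`!%:R / (n - j + k.+1)`!%:R) :> R.
  rewrite ler_pdivrMr ?exprn_gt0 // ler_pdivrMr ?exprn_gt0 ?ltr0n //.
  apply: le_trans (IH _) _; rewrite -addnn -addnA exprD [X in 4 ^+ X]/=.
  apply: le_of_eq; have -> : 4 = 2 ^+ 2 :> R by ring.
  by rewrite -!exprM mulnC; ring.
have e2 : (central j)%:R ^+ 2 / (2 ^+ j) ^+ 2 <= j.+1%:R^-1 :> R.
  rewrite ler_pdivrMr ?exprn_gt0 ?ltr0n //.
  apply: le_trans (cen _) _; apply: le_of_eq; have -> : 4 = 2 ^+ 2 :> R by ring.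
  by rewrite -!exprM mulnC; ring.
have -> : 'C(n, j)%:R * 2 ^+ n * (((central j)%:R / 2 ^+ j *
    ((closed_walks k.+1 (n - j))%:R / 2 ^+ (n - j))) ^+ 2 / k.+1%:R ^+ (n - j)) =
  2 ^+ n * ('C(n, j)%:R * ((central j)%:R ^+ 2 / (2 ^+ j) ^+ 2 *
   ((closed_walks k.+1 (n - j))%:R ^+ 2 / (2 ^+ (n - j)) ^+ 2 / k.+1%:R ^+ (n - j)))) :> R.
  by field; rewrite !expf_neq0 ?lt0r_neq0.
rewrite -[leRHS]mulrA; apply: ler_wpM2l; first by rewrite exprn_ge0.
apply: (@le_trans _ _ ('C(n, j)%:R * (j.+1%:R^-1 *
   (k.+1%:R ^+ (n - j + k.+1) * ((n - j)`!%:R / (n - j + k.+1)`!%:R))))).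
  apply: ler_wpM2l; first exact: ler0n.
  exact: ler_pM.
have f1 : 'C(n, j)%:R * j`!%:R * (n - j)`!%:R = n`!%:R :> R.
  by rewrite -!natrM -mulnA bin_fact.
have f2 : 'C(n + k.+2, j.+1)%:R * (j.+1%:R * j`!%:R) * (n - j + k.+1)`!%:R = (n + k.+2)`!%:R :> R.
  rewrite -!natrM -factS; have -> : (n - j + k.+1 = n + k.+2 - j.+1)%N by lia.
  by rewrite -mulnA bin_fact //; lia.
apply: le_of_eq.
rewrite -f1 -f2; field.
by rewrite nat1r !pnatr_eq0 -!lt0n !fact_gt0 bin_gt0 /=; lia.
Qed.

(** The probability that the simple random walk is back after n steps, see
    [avg_return_ret]. *)
Definition ret (d n : nat) : R := (closed_walks d n)%:R / (2 * d)%:R ^+ n.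

(** The mean number of pairs (i, j) with i + j < M such that two independent
    walks from one point are together at times i and j: reversing one of them,
    each of the n + 1 pairs with i + j = n has probability [ret d n]. *)
Definition green (d M : nat) : R := \sum_(n < M) n.+1%:R * ret d n.

Lemma ret_ge0 (d n : nat) : 0 <= ret d n.
Proof. by rewrite divr_ge0 ?exprn_ge0 ?ler0n. Qed.

Lemma ret0 (d : nat) : ret d 0 = 1.
Proof.
rewrite /ret expr0 divr1; suff -> : closed_walks d 0 = 1%N by [].
by elim: d => // d IH; rewrite /= big_ord_recl big_ord0 /= subnn IH.
Qed.

Lemma ret1 (d : nat) : ret d 1 = 0.
Proof. by rewrite /ret closed_walks1 mul0r. Qed.

Lemma ret_ratio (d n : nat) : (0 < d)%N ->
  ret d n.+2 <= n.+1%:R / (2 * d)%:R * ret d n.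
Proof.
move=> d0; have dp : 0 < (2 * d)%:R :> R by rewrite ltr0n muln_gt0.
rewrite /ret ler_pdivrMr ?exprn_gt0 //.
have -> : n.+1%:R / (2 * d)%:R * ((closed_walks d n)%:R / (2 * d)%:R ^+ n) *
    (2 * d)%:R ^+ n.+2 = (2 * d)%:R * n.+1%:R * (closed_walks d n)%:R :> R.
  rewrite !exprS; move: (2 * d)%:R dp => c cp; have c0 := lt0r_neq0 cp; field.
  by rewrite ?expf_neq0 ?c0.
by rewrite -!natrM ler_nat closed_walks_ratio.
Qed.

Lemma expn_fact_le (n k : nat) : (n.+1 ^ k * n`! <= (n + k)`!)%N.
Proof.
elim: k => [|k IH]; first by rewrite mul1n addn0.
rewrite expnS addnS factS -mulnA leq_mul //.
by rewrite ltnS leq_addr.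
Qed.

(** Return probabilities decay like n^(-d/2), with a constant good enough to
    be summed uniformly in d. *)
Lemma ret_sqr (d n : nat) : (0 < d)%N ->
  ret d n ^+ 2 <= (d%:R / n.+1%:R) ^+ d.
Proof.
case: d => // k _; set d := k.+1.
have dp : 0 < d%:R :> R by rewrite ltr0n.
have np : 0 < n.+1%:R :> R by rewrite ltr0n.
rewrite /ret expr_div_n ler_pdivrMr ?exprn_gt0 ?ltr0n //.
apply: le_trans (closed_walks_sqr k n) _; rewrite -/d.
have -> : ((2 * d)%:R ^+ n) ^+ 2 = 4 ^+ n * d%:R ^+ n.*2 :> R.
  rewrite natrM exprMn exprMn -!exprM muln2; congr (_ * _).
  by rewrite -muln2 mulnC exprM; congr (_ ^+ _); ring.
rewrite exprD mulrCA [leRHS]mulrC.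
have -> : 4 ^+ n * d%:R ^+ n.*2 * (d%:R / n.+1%:R) ^+ d =
  4 ^+ n * (d%:R ^+ n.*2 * d%:R ^+ d * (n.+1%:R ^+ d)^-1) :> R.
  by rewrite expr_div_n; ring.
have -> : d%:R ^+ n.*2 * d%:R ^+ d * (4 ^+ n * (n`!%:R / (n + d)`!%:R)) =
  4 ^+ n * (d%:R ^+ n.*2 * d%:R ^+ d * (n`!%:R / (n + d)`!%:R)) :> R by ring.
rewrite !ler_pM2l ?exprn_gt0 ?mulr_gt0 ?exprn_gt0 //.
rewrite ler_pdivrMr ?ltr0n ?fact_gt0 // mulrC ler_pdivlMr ?exprn_gt0 //.
by rewrite -natrX -natrM ler_nat mulnC expn_fact_le.
Qed.

Lemma sum_inv_sqr (N M : nat) : (0 < N)%N ->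
  \sum_(N <= n < M) n.+1%:R ^- 2 <= N%:R^-1 :> R.
Proof.
move=> N0; case: (leqP M N) => [h|/ltnW h].
  by rewrite big_geq // invr_ge0 ler0n.
apply: (@le_trans _ _ (N%:R^-1 - M%:R^-1)); last by rewrite gerBl invr_ge0 ler0n.
have -> : N%:R^-1 - M%:R^-1 =
    \sum_(N <= n < M) (- n.+1%:R^-1 - - n%:R^-1) :> R.
  by rewrite (telescope_sumr (fun n => - n%:R^-1)) // opprK addrC.
apply: ler_sum_nat => n /andP[Nn _]; rewrite opprK.
have n0 : (0 < n)%N by apply: leq_trans Nn.
have np : 0 < n%:R :> R by rewrite ltr0n.
have -> : - n.+1%:R^-1 + n%:R^-1 = (n%:R * n.+1%:R)^-1 :> R.
  by rewrite -natr1; field; rewrite !lt0r_neq0 // addr_gt0.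
rewrite lef_pV2 ?posrE ?exprn_gt0 ?mulr_gt0 ?ltr0n //.
by rewrite expr2 ler_pM2r ?ltr0n // ler_nat.
Qed.

Lemma expn6_le_exp2 (d : nat) : (30 <= d)%N -> (d ^ 6 <= 2 ^ d)%N.
Proof.
elim: d => // d IH; rewrite leq_eqVlt => /orP[/eqP <-|dgt].
  have e : (30 = 5 * 6)%N by [].
  by rewrite [X in (_ <= 2 ^ X)%N]e expnM leq_exp2r.
have {}dgt : (30 <= d)%N by rewrite -ltnS.
rewrite [leqRHS]expnS; have := IH dgt; move: (2 ^ d)%N => y {IH} IH.
apply: (@leq_trans (2 * d ^ 6)); last by rewrite leq_mul2l.
rewrite !expnS !expn0; nia.
Qed.
End RealBounds.

(** * Summing the return probabilities *)

Section GreenBounds.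
Variable R : rcfType.

(** The terms are of order (n + 1)^(1 - d/2), hence for d >= 5 at most
    (n + 1)^(-3/2) up to a constant, and this is dominated by the increments of
    1 / sqrt n. *)
Lemma green_finite (d : nat) : (5 <= d)%N ->
  exists B : R, forall M, green R d M <= B.
Proof.
move=> d5; have d0 : (0 < d)%N by apply: leq_trans d5.
pose D : R := d%:R ^+ 5.
pose s (n : nat) : R := Num.sqrt n%:R.
have sp n : (0 < n)%N -> 0 < s n by move=> n0; rewrite sqrtr_gt0 ltr0n.
have s2 n : s n ^+ 2 = n%:R by rewrite sqr_sqrtr ?ler0n.
have D1 : 1 <= D by rewrite exprn_ege1 // ler1n.
have retle n : (d <= n.+1)%N -> n.+1%:R * ret R d n <= D / s n.+1 ^+ 3.
  move=> dn; have sn := sp n.+1 isT.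
  have h : ret R d n <= D / s n.+1 ^+ 5.
    rewrite -(@ler_pXn2r _ 2) ?nnegrE ?ret_ge0 //; last first.
      by apply: divr_ge0; [exact: le_trans D1 | rewrite exprn_ge0 ?ltW].
    apply: le_trans (ret_sqr R n d0) _.
    apply: (@le_trans _ _ ((d%:R / n.+1%:R) ^+ 5)).
      apply: ler_wiXn2l => //.
      by rewrite ler_pdivrMr ?ltr0n // mul1r ler_nat.
    have -> : (D / s n.+1 ^+ 5) ^+ 2 = D ^+ 2 / n.+1%:R ^+ 5.
      by rewrite expr_div_n -[(s _ ^+ 5) ^+ 2]exprM (mulnC 5 2) exprM s2.
    rewrite expr_div_n -/D ler_pM2r; last first.
      by rewrite invr_gt0 exprn_gt0 ?ltr0n.
    by rewrite expr2 ler_peMl // (le_trans ler01).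
  rewrite -s2; apply: le_trans (ler_wpM2l _ h) _; first by rewrite exprn_ge0 ?ltW.
  apply: le_of_eq; field; exact: lt0r_neq0.
have tele n : (0 < n)%N -> 1 / s n.+1 ^+ 3 <= 2 * ((s n)^-1 - (s n.+1)^-1).
  move=> n0; have a0 := sp n n0; have b0 := sp n.+1 isT.
  have e : s n.+1 ^+ 2 = s n ^+ 2 + 1 by rewrite !s2 -natr1.
  have ab : s n <= s n.+1 by apply: ler_wsqrtr; rewrite ler_nat.
  move: (s n) (s n.+1) a0 b0 e ab => a b a0 b0 e ab.
  have -> : 2 * (a^-1 - b^-1) = 2 / (a * b * (a + b)).
    have e1 : (b - a) * (b + a) = 1 by rewrite -subr_sqr e; ring.
    have abp : 0 < a + b by rewrite addr_gt0.
    have -> : 2 / (a * b * (a + b)) = 2 * ((b - a) * (b + a)) / (a * b * (a + b)).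
      by rewrite e1 mulr1.
    by field; rewrite !lt0r_neq0.
  rewrite ler_pdivrMr ?exprn_gt0 // mulrAC ler_pdivlMr ?mulr_gt0 ?addr_gt0 // mul1r.
  have h1 : a * b <= b * b by rewrite ler_pM2r.
  have h2 : a + b <= 2 * b by lra.
  apply: (@le_trans _ _ ((b * b) * (2 * b))).
    apply: ler_pM => //; [by rewrite mulr_ge0 ?ltW | by rewrite addr_ge0 ?ltW].
  by apply: le_of_eq; ring.
exists (green R d d + D * 2 * (s d)^-1) => M.
have monog a b : (a <= b)%N -> green R d a <= green R d b.
  move=> ab; rewrite /green -(big_mkord xpredT (fun n => n.+1%:R * ret R d n)).
  rewrite -[leRHS](big_mkord xpredT (fun n => n.+1%:R * ret R d n)).
  rewrite [leRHS](@big_cat_nat _ _ _ a) //= lerDl sumr_ge0 // => i _.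
  by rewrite mulr_ge0 ?ret_ge0 ?ler0n.
case: (leqP M d) => [/monog h|/ltnW dM].
  apply: le_trans h _; rewrite lerDl; apply: mulr_ge0; last first.
    by rewrite invr_ge0 ltW ?sp.
  by rewrite mulr_ge0 // (le_trans ler01).
rewrite /green -(big_mkord xpredT (fun n => n.+1%:R * ret R d n)).
rewrite (@big_cat_nat _ _ _ d) //= big_mkord lerD2l.
apply: (@le_trans _ _ (\sum_(d <= n < M) D * 2 * (- (s n.+1)^-1 - - (s n)^-1))).
  apply: ler_sum_nat => n /andP[dn _].
  have n0 : (0 < n)%N by apply: leq_trans dn.
  apply: le_trans (retle n _) _; first by apply: leq_trans dn _.
  rewrite -mulrA; apply: ler_wpM2l; first by rewrite (le_trans ler01).
  rewrite opprK [- _ + _]addrC; apply: le_trans (tele _ n0).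
  by rewrite mul1r.
rewrite -mulr_sumr (telescope_sumr (fun n => - (s n)^-1)) //.
apply: ler_wpM2l; first by rewrite mulr_ge0 // (le_trans ler01).
have M0 : (0 < M)%N by apply: leq_trans dM.
by rewrite opprK addrC gerBl invr_ge0 ltW ?sp.
Qed.

(** The terms n = 2 and n = 4 are of order 1/d; for 5 <= n < 2d the ratio bound
    keeps [ret d n] below the bound for n = 6, of order d^(-3), and there are at
    most 2d terms, of weight at most 2d; beyond 2d, [ret_sqr] gives
    8 / (n + 1)^3 because d^6 <= 2^d. *)
Lemma green_large (d : nat) : (30 <= d)%N ->
  forall M, green R d M <= 1 + 18 / d%:R.
Proof.
move=> d30 M; have d0 : (0 < d)%N by apply: leq_trans d30.
have dp : 0 < d%:R :> R by rewrite ltr0n.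
have d30' : 30 <= d%:R :> R by rewrite (ler_nat R 30 d).
have ratio n := ret_ratio R n d0.
have r2 : ret R d 2 <= 1 / (2 * d%:R).
  by apply: le_trans (ratio _) _; rewrite ret0 natrM mulr1.
have r4 : ret R d 4 <= 3 / (4 * d%:R ^+ 2).
  apply: le_trans (ratio _) _; apply: le_trans (ler_wpM2l _ r2) _ => //.
  by rewrite natrM; apply: le_of_eq; field; exact: lt0r_neq0.
have r6 : ret R d 6 <= 2 / d%:R ^+ 3.
  apply: le_trans (ratio _) _; apply: le_trans (ler_wpM2l _ r4) _ => //.
  have -> : 5 / (2 * d)%:R * (3 / (4 * d%:R ^+ 2)) = (15 / 8) / d%:R ^+ 3 :> R.
    by rewrite natrM; field; exact: lt0r_neq0.
  by rewrite ler_pM2r ?invr_gt0 ?exprn_gt0 //; lra.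
have odd0 n : odd n -> ret R d n = 0.
  move=> on; rewrite -(odd_double_half n) on add1n.
  elim: (n./2) => [|k IH]; first by rewrite double0 ret1.
  apply/eqP; rewrite eq_le ret_ge0 andbT doubleS; apply: le_trans (ratio _) _.
  by rewrite IH mulr0.
have mid n : (5 <= n)%N -> (n < 2 * d)%N -> ret R d n <= 2 / d%:R ^+ 3.
  have pos3 : 0 <= 2 / d%:R ^+ 3 :> R by rewrite divr_ge0 ?exprn_ge0.
  have [k] := ubnP n; elim: k n => // k IH n nk n5 n2d.
  have [n8|n8] := leqP 8 n; last first.
    move: n5 n8 {nk n2d}; case: n => // -[|[|[|[|[|[|[|[|n]]]]]]]] //= _ _.
    + by rewrite (odd0 5).
    + by rewrite (odd0 7).
  have e : n = (n.-2).+2 by lia.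
  rewrite e; apply: le_trans (ratio _) _.
  apply: le_trans (ler_wpM2l _ (IH n.-2 _ _ _)) _; first by rewrite divr_ge0 ?ler0n.
  - by lia.
  - by lia.
  - by lia.
  rewrite -[leRHS]mul1r; apply: ler_wpM2r => //.
  by rewrite ler_pdivrMr ?ltr0n ?muln_gt0 // mul1r ler_nat; lia.
have big n : (2 * d <= n)%N -> ret R d n <= 8 / n.+1%:R ^+ 3.
  move=> dn; have np : 0 < n.+1%:R :> R by rewrite ltr0n.
  rewrite -(@ler_pXn2r _ 2) ?nnegrE ?ret_ge0 ?divr_ge0 ?exprn_ge0 ?ler0n //.
  apply: le_trans (ret_sqr R n d0) _.
  have e : d = (6 + (d - 6))%N by lia.
  rewrite [X in _ ^+ X]e exprD.
  have half : d%:R / n.+1%:R <= 2^-1 :> R.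
    rewrite ler_pdivrMr // ler_pdivlMl // -(natrM R 2) ler_nat; lia.
  have h1 : (d%:R / n.+1%:R) ^+ (d - 6) <= 64 / d%:R ^+ 6 :> R.
    apply: (@le_trans _ _ (2^-1 ^+ (d - 6))).
      by apply: lerXn2r; rewrite ?nnegrE ?divr_ge0 ?ler0n ?invr_ge0.
    rewrite exprVn ler_pdivlMr ?exprn_gt0 // ler_pdivrMl ?exprn_gt0 //.
    have -> : 64 = 2 ^+ 6 :> R by ring.
    rewrite -exprD subnK; last by lia.
    by rewrite -!natrX ler_nat expn6_le_exp2.
  apply: le_trans (ler_wpM2l _ h1) _; first by rewrite exprn_ge0 ?divr_ge0 ?ler0n.
  rewrite expr_div_n expr_div_n -exprM.
  by apply: le_of_eq; field; rewrite -nat1r in np; rewrite !lt0r_neq0.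
have term n : 0 <= n.+1%:R * ret R d n by rewrite mulr_ge0 ?ret_ge0 ?ler0n.
pose f n : R := n.+1%:R * ret R d n.
pose M' := maxn M (2 * d).
apply: (@le_trans _ _ (\sum_(0 <= n < M') f n)).
  rewrite /green -(big_mkord xpredT f) [leRHS](@big_cat_nat _ _ _ M) //=; last exact: leq_maxl.
  by rewrite lerDl; apply: sumr_ge0 => i _; exact: term.
rewrite (@big_cat_nat _ _ _ (2 * d)) //=; last exact: leq_maxr.
rewrite (@big_cat_nat _ _ _ 5) //=; last by lia.
have s1 : \sum_(0 <= n < 5) f n <= 1 + (3 / 2) / d%:R + 4 / d%:R.
  rewrite !big_nat_recl // big_geq // /f ret0 ret1 (odd0 3) //.
  have h2 : 3 * ret R d 2 <= (3 / 2) / d%:R.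
    apply: le_trans (ler_wpM2l _ r2) _ => //.
    by apply: le_of_eq; field; exact: lt0r_neq0.
  have h4 : 5 * ret R d 4 <= 4 / d%:R.
    apply: le_trans (ler_wpM2l _ r4) _ => //.
    rewrite -subr_ge0.
    have -> : 4 / d%:R - 5 * (3 / (4 * d%:R ^+ 2)) = (4 * d%:R - 15 / 4) / d%:R ^+ 2 :> R.
      by field; exact: lt0r_neq0.
    by rewrite divr_ge0 ?exprn_ge0 //; lra.
  by move: h2 h4; move: (ret R d 2) (ret R d 4) (d%:R^-1) => a b c; lra.
have s2 : \sum_(5 <= n < 2 * d) f n <= 8 / d%:R.
  apply: (@le_trans _ _ (\sum_(0 <= n < 2 * d) (2 * d)%:R * (2 / d%:R ^+ 3))).
    rewrite [leRHS](@big_cat_nat _ _ _ 5) //=; last by lia.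
    rewrite -[leLHS]add0r; apply: lerD.
      by apply: sumr_ge0 => i _; rewrite mulr_ge0 ?divr_ge0 ?exprn_ge0 ?ler0n.
    apply: ler_sum_nat => n /andP[n5 n2d]; apply: ler_pM.
    - exact: ler0n.
    - exact: ret_ge0.
    - by rewrite ler_nat.
    - exact: mid.
  rewrite sumr_const_nat subn0 -mulr_natr natrM.
  by apply: le_of_eq; field; exact: lt0r_neq0.
have s3 : \sum_(2 * d <= n < M') f n <= 4 / d%:R.
  apply: (@le_trans _ _ (8 * \sum_(2 * d <= n < M') n.+1%:R ^- 2)).
    rewrite mulr_sumr; apply: ler_sum_nat => n /andP[h _].
    apply: le_trans (ler_wpM2l _ (big n h)) _; first exact: ler0n.
    have := ltr0Sn R n; move: (n.+1%:R) => y y0.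
    by apply: le_of_eq; field; exact: lt0r_neq0.
  apply: le_trans (ler_wpM2l _ (sum_inv_sqr R _ _)) _ => //; first by lia.
  by rewrite natrM; apply: le_of_eq; field; exact: lt0r_neq0.
have x0 : 0 <= d%:R^-1 :> R by rewrite invr_ge0 ltW.
move: s1 s2 s3 x0; move: (\sum_(0 <= n < 5) f n) (\sum_(5 <= n < 2 * d) f n) (\sum_(2 * d <= n < M') f n) (d%:R^-1) => a b c x; lra.
Qed.
End GreenBounds.

(** * Random walk as a mean over words of steps *)

Section StepWords.
Variables (R : realFieldType) (d : nat).

Definition stepv (s : 'I_d * bool) : 'rV[int]_d :=
  (if s.2 then 1 else -1) *: delta_mx ord0 s.1.

Definition walk (v : 'rV[int]_d) (u : seq ('I_d * bool)) (i : nat) : 'rV[int]_d :=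
  v + \sum_(s <- take i u) stepv s.

(** The recursion on the first letter makes [avg_cat], the independence of
    disjoint blocks of steps, immediate. *)
Fixpoint avg (n : nat) (f : seq ('I_d * bool) -> R) : R :=
  if n is n'.+1 then (2 * d)%:R^-1 * \sum_s avg n' (fun u => f (s :: u))
  else f [::].

End StepWords.

Section ReturnCount.
Variable d : nat.
Implicit Types (g h : 'rV[int]_d -> nat) (x : 'rV[int]_d) (i k : 'I_d).

Local Notation e k := (delta_mx ord0 k : 'rV[int]_d).

Definition axis_sum (k : 'I_d) (g : 'rV[int]_d -> nat) (x : 'rV[int]_d) : nat :=
  (g (x + e k)%R + g (x - e k)%R)%N.

Definition axes_sum (K : nat) (g : 'rV[int]_d -> nat) (x : 'rV[int]_d) : nat :=
  (\sum_(i < d | (i < K)%N) axis_sum i g x)%N.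

Lemma axis_sumC i k g : axis_sum i (axis_sum k g) = axis_sum k (axis_sum i g).
Proof.
apply/funext => x; rewrite /axis_sum.
rewrite (addrAC x (e i) (e k)) (addrAC x (e i) (- e k)).
by rewrite (addrAC x (- e i) (e k)) (addrAC x (- e i) (- e k)) addnACA.
Qed.

Lemma axes_sum_axis K k g :
  axes_sum K (axis_sum k g) = axis_sum k (axes_sum K g).
Proof.
apply/funext => x; rewrite /axes_sum [RHS]/axis_sum -big_split /=.
by apply: eq_bigr => i _; rewrite axis_sumC.
Qed.

Lemma axes_sum_iter_axis K k j g :
  axes_sum K (iter j (axis_sum k) g) = iter j (axis_sum k) (axes_sum K g).
Proof. by elim: j => //= j IH; rewrite axes_sum_axis IH. Qed.

Lemma axes_sumS k g x : axes_sum k.+1 g x = (axis_sum k g x + axes_sum k g x)%N.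
Proof.
rewrite /axes_sum (bigD1 k) //=; congr (_ + _)%N; apply: eq_bigl => i.
by rewrite ltnS ltn_neqAle andbC.
Qed.

Lemma axis_sum_sum k n (c : nat -> nat) (F : nat -> 'rV[int]_d -> nat) x :
  axis_sum k (fun y => \sum_(j < n) c j * F j y)%N x =
  (\sum_(j < n) c j * axis_sum k (F j) x)%N.
Proof. by rewrite /axis_sum -big_split; apply: eq_bigr => j _; rewrite mulnDr. Qed.

Lemma axes_sum_sum K n (c : nat -> nat) (F : nat -> 'rV[int]_d -> nat) x :
  axes_sum K (fun y => \sum_(j < n) c j * F j y)%N x =
  (\sum_(j < n) c j * axes_sum K (F j) x)%N.
Proof.
rewrite /axes_sum; under eq_bigr => i _ do rewrite axis_sum_sum.
by rewrite exchange_big; apply: eq_bigr => j _; rewrite big_distrr.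
Qed.

(** The operators that sum over the two neighbours along an axis commute, so
    powers of their sum expand by the binomial formula; this separates the last
    axis from the others. *)
Lemma axes_sum_binomial k n g x :
  iter n (axes_sum k.+1) g x =
  (\sum_(j < n.+1) 'C(n, j) * iter j (axis_sum k) (iter (n - j) (axes_sum k) g) x)%N.
Proof.
elim: n x => [|n IH] x; first by rewrite big_ord_recl big_ord0 bin0 mul1n addn0.
rewrite iterS (_ : iter n _ g = fun y => \sum_(j < n.+1) 'C(n, j) *
  iter j (axis_sum k) (iter (n - j) (axes_sum k) g) y)%N; last exact/funext.
pose F j := iter j (axis_sum k) (iter (n - j) (axes_sum k) g).
rewrite axes_sumS (axis_sum_sum _ _ (fun j => 'C(n, j)) F).
rewrite (axes_sum_sum _ _ (fun j => 'C(n, j)) F).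
have e2 (j : 'I_n.+1) : axes_sum k (F j) = iter j (axis_sum k) (iter (n.+1 - j) (axes_sum k) g).
  by rewrite /F axes_sum_iter_axis -iterS -subSn // -ltnS.
under [X in (_ + X)%N]eq_bigr => j _ do rewrite e2.
rewrite [RHS]big_ord_recl /= bin0 mul1n.
under [X in (_ = _ + X)%N]eq_bigr => j _ do rewrite /bump /= add1n binS mulnDl subSS.
rewrite [X in (_ = _ + X)%N]big_split /= addnA [RHS]addnC; congr (_ + _)%N.
rewrite [RHS](congr1 _ (big_ord_recr _ _)) /= bin_small // mul0n addn0.
by rewrite [LHS]big_ord_recl /= bin0 mul1n.
Qed.

(** The number of walks of j steps on the line from 0 to z: the position j + z
    must be an even number 2m, where m counts the steps to the right. *)
Definition line_count (j : nat) (z : int) : nat :=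
  match (z + j%:Z)%R with
  | Posz m => if odd m then 0 else 'C(j, m./2)
  | Negz _ => 0
  end.

Lemma line_count0 z : line_count 0 z = (z == 0) :> nat.
Proof.
rewrite /line_count addr0; case: z => // -[//|[//|m]].
by rewrite /= negbK; case: ifP.
Qed.

Lemma line_countS j z :
  line_count j.+1 z = (line_count j (z + 1) + line_count j (z - 1))%N.
Proof.
rewrite /line_count.
have -> : z + 1 + j = z + j.+1 by lia.
have -> : z - 1 + j = z + j.+1 - 2%:Z by lia.
case: (z + j.+1) => [[|[|m]]|m] //=; first by rewrite !bin0.
by rewrite subn2 negbK /=; case: ifP => //; rewrite binS.
Qed.

Lemma iter_axis_sum k g j (z : int) :
  (forall z : int, z != 0 -> g (z *: e k) = 0%N) ->
  iter j (axis_sum k) g (z *: e k) = (line_count j z * g 0%R)%N.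
Proof.
move=> g0; elim: j z => [|j IH] z.
  rewrite line_count0 /=; case: eqVneq => [->|/g0 ->]; last by [].
  by rewrite scale0r mul1n.
rewrite iterS {1}/axis_sum line_countS mulnDl.
have -> : z *: e k + e k = (z + 1) *: e k by rewrite scalerDl scale1r.
have -> : z *: e k - e k = (z - 1) *: e k by rewrite scalerBl scale1r.
by rewrite !IH.
Qed.

Lemma iter_axes_sum_support (K n : nat) g x k : (K <= k)%N ->
  (forall y : 'rV[int]_d, y ord0 k != 0 -> g y = 0%N) -> x ord0 k != 0 ->
  iter n (axes_sum K) g x = 0%N.
Proof.
move=> Kk g0; elim: n x => [|n IH] x xk; first exact: g0.
rewrite iterS; apply: big1 => i iK.
have ik : (i == k) = false by apply/negbTE/eqP => ik; rewrite -ik leqNgt iK in Kk.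
by rewrite /axis_sum !IH // !mxE eqxx /= (eq_sym k) ik ?oppr0 addr0.
Qed.

Lemma iter_axes_sum_origin (K n : nat) : (K <= d)%N ->
  iter n (axes_sum K) (fun x => (x == 0) : nat) 0 = closed_walks K n.
Proof.
elim: K n => [|K IH] n Kd.
  case: n => [|n]; first by rewrite /= eqxx.
  by rewrite iterS /= /axes_sum big_pred0.
rewrite (axes_sum_binomial (Ordinal Kd)) /=; apply: eq_bigr => j _.
rewrite -mulnA; congr (_ * _)%N; have := scale0r (e (Ordinal Kd)).
move=> e0; rewrite -[X in iter j _ _ X]e0 iter_axis_sum.
  by rewrite IH ?(ltnW Kd) // /line_count add0r.
move=> z z0; apply: (@iter_axes_sum_support _ _ _ _ (Ordinal Kd)) => //.
- by move=> y; case: (eqVneq y 0) => // ->; rewrite mxE eqxx.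
- by rewrite !mxE !eqxx mulr1.
Qed.

Lemma sum_stepv (V : nmodType) (F : 'rV[int]_d -> V) :
  \sum_s F (stepv s) = \sum_i (F (e i) + F (- e i)).
Proof.
transitivity (\sum_(p : 'I_d * bool) F (stepv (p.1, p.2))).
  by apply: eq_bigr => -[].
rewrite -(pair_bigA _ (fun i b => F (stepv (i, b)))) /=.
by apply: eq_bigr => i _; rewrite big_bool /stepv /= scale1r scaleN1r.
Qed.

Lemma avg_return (R : realFieldType) (n : nat) x : 
  avg n (fun u => (x + \sum_(s <- u) stepv s == 0)%:R) =
  (iter n (axes_sum d) (fun y => (y == 0) : nat) x)%:R / (2 * d)%:R ^+ n :> R.
Proof.
elim: n x => [|n IH] x; first by rewrite /= big_nil addr0 expr0 divr1.
rewrite [avg _ _]/= iterS.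
have -> : \sum_s avg n (fun u => (x + \sum_(s' <- s :: u) stepv s' == 0)%:R) =
   \sum_s (iter n (axes_sum d) (fun y => (y == 0) : nat) (x + stepv s))%:R / (2 * d)%:R ^+ n :> R.
  apply: eq_bigr => s _; rewrite -IH; congr avg; apply/funext => u.
  by rewrite big_cons addrA.
rewrite -mulr_suml exprS invfM mulrCA mulrA [RHS]mulrA; congr (_ / _).
congr (_ * _).
move: (iter n _ _) => g.
have -> : axes_sum d g x = (\sum_i axis_sum i g x)%N.
  by apply: eq_bigl => i; rewrite ltn_ord.
rewrite (sum_stepv (fun y => (g (x + y))%:R)) natr_sum.
by apply: eq_bigr => i _; rewrite natrD.
Qed.

Lemma avg_return_ret (R : realFieldType) (n : nat) :
  avg n (fun u => (\sum_(s <- u) @stepv d s == 0)%:R) = ret R d n.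
Proof.
rewrite /ret -iter_axes_sum_origin // -avg_return; congr avg; apply/funext => u.
by rewrite add0r.
Qed.
End ReturnCount.

(** * Cut times *)

Section Averages.
Variables (R : realFieldType) (d : nat).
Notation word := (seq ('I_d * bool)).
Implicit Types (f g : word -> R) (u w : word) (v : 'rV[int]_d).

Lemma eq_avg n f g : (forall u, size u = n -> f u = g u) -> avg n f = avg n g.
Proof.
elim: n f g => [|n IH] f g fg /=; first exact: fg.
by congr (_ * _); apply: eq_bigr => s _; apply: IH => u un; apply: fg; rewrite /= un.
Qed.

Lemma avg_le n f g : (forall u, size u = n -> f u <= g u) -> avg n f <= avg n g.
Proof.
elim: n f g => [|n IH] f g fg /=; first exact: fg.
apply: ler_wpM2l; first by rewrite invr_ge0 ler0n.
by apply: ler_sum => s _; apply: IH => u un; apply: fg; rewrite /= un.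
Qed.

Lemma avg_cat m n f :
  avg (m + n) f = avg m (fun u => avg n (fun w => f (u ++ w))).
Proof.
elim: m f => [//|m IH] f; rewrite addSn /=; congr (_ * _).
by apply: eq_bigr => s _; rewrite IH.
Qed.

Lemma avgZl n (c : R) f : avg n (fun u => c * f u) = c * avg n f.
Proof.
elim: n f => [//|n IH] f /=; rewrite mulrCA; congr (_ * _).
by rewrite mulr_sumr; apply: eq_bigr => s _; rewrite IH.
Qed.

Lemma avg_sum n (I : Type) (r : seq I) (P : pred I) (F : I -> word -> R) :
  avg n (fun u => \sum_(i <- r | P i) F i u) = \sum_(i <- r | P i) avg n (F i).
Proof.
elim: n F => [//|n IH] F /=; rewrite -mulr_sumr; congr (_ * _).
by rewrite exchange_big; apply: eq_bigr => s _; rewrite IH.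
Qed.

Lemma avgD n f g : avg n (fun u => f u + g u) = avg n f + avg n g.
Proof.
elim: n f g => [//|n IH] f g /=; rewrite -mulrDr -big_split; congr (_ * _).
by apply: eq_bigr => s _; rewrite IH.
Qed.

Lemma avg_const n (c : R) : (0 < d)%N -> avg n (fun _ : word => c) = c.
Proof.
move=> d0; elim: n => [//|n IH] /=; rewrite IH sumr_const card_prod card_ord card_bool.
rewrite -[c *+ _]mulr_natr (mulnC d 2) mulrCA mulVf ?mulr1 // pnatr_eq0; lia.
Qed.

Lemma walk0 v u : walk v u 0 = v.
Proof. by rewrite /walk take0 big_nil addr0. Qed.

Lemma walk_catl v u w i : (i <= size u)%N -> walk v (u ++ w) i = walk v u i.
Proof. by move=> iu; rewrite /walk takel_cat. Qed.

Lemma walk_catr v u w i :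
  walk v (u ++ w) (size u + i) = walk (walk v u (size u)) w i.
Proof.
by rewrite /walk takeD take_size_cat // drop_size_cat // big_cat addrA take_size.
Qed.

Lemma walk_shift v u i : walk v u i = v + walk 0 u i.
Proof. by rewrite /walk add0r. Qed.

End Averages.

(** Recording only which times are spent at the same place makes the events
    below both local in time and invariant under translations of the path. *)
Definition same_pattern (T : eqType) (n : nat) (x y : nat -> T) :=
  forall i j, (i <= n)%N -> (j <= n)%N -> (x i == x j) = (y i == y j).

Definition pattern_fun (T : eqType) (A : Type) (n : nat) (Q : (nat -> T) -> A) :=
  forall x y, same_pattern n x y -> Q x = Q y.

Lemma pattern_boolr (R : realFieldType) (T : eqType) n (Q : (nat -> T) -> bool) :
  pattern_fun n Q -> pattern_fun n (fun x : nat -> T => (Q x)%:R : R).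
Proof. by move=> pQ x y /pQ ->. Qed.

(** The future is truncated at f positions, so that the event depends on finitely
    many steps. *)
Definition cut (T : eqType) (x : nat -> T) (i f : nat) : bool :=
  [forall j : 'I_i.+1, forall k : 'I_f, x j != x (i + k.+1)%N].

Lemma cutP (T : eqType) (x : nat -> T) i f :
  reflect (forall j k, (j <= i)%N -> (i < k <= i + f)%N -> x j <> x k) (cut x i f).
Proof.
apply: (iffP idP) => [/forallP h j k ji /andP[ik kf] e|h].
  have ji' : (j < i.+1)%N by [].
  have kf' : (k - i.+1 < f)%N by lia.
  have /forallP/(_ (Ordinal kf')) /= := h (Ordinal ji').
  by rewrite (_ : i + (k - i.+1).+1 = k)%N ?e ?eqxx //; lia.
apply/forallP => j; apply/forallP => k; apply/eqP; apply: h.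
  by rewrite -ltnS.
by rewrite leq_add2l ltn_ord andbT addnS ltnS leq_addr.
Qed.

Lemma pattern_cut (T : eqType) n i f : (i + f <= n)%N -> pattern_fun n (fun x : nat -> T => cut x i f).
Proof.
move=> ifn x y xy; apply/cutP/cutP => h j k ji kf /eqP.
  by rewrite -xy; [move/eqP; apply: h | lia | lia].
by rewrite xy; [move/eqP; apply: h | lia | lia].
Qed.

Lemma cut_window (T : eqType) (x : nat -> T) s i f g : (f <= g)%N ->
  cut x (s + i) g -> cut (fun t => x (s + t)%N) i f.
Proof. by move=> fg /cutP h; apply/cutP => j k ji kf; apply: h; lia. Qed.

(** A loop from time j to time j + n that is the last contact of past and future:
    deleting it leaves a cut at time j. *)
Definition last_meeting (T : eqType) (x : nat -> T) (j n f : nat) : bool :=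
  (x j == x (j + n)%N) &&
  [forall j' : 'I_j.+1, forall k : 'I_f, x j' != x (j + n + k.+1)%N].

(** Take the latest time at which the path visits a place of the past of i, the
    time i itself being one; nothing after it meets that past. *)
Lemma last_meeting_exists (T : eqType) (x : nat -> T) i f :
  (1 <= \sum_(a < i.+1) \sum_(b < f.+1) last_meeting x (i - a) (a + b) (f - b))%N.
Proof.
pose P b := (b <= f)%N && [exists a : 'I_i.+1, x (i - a)%N == x (i + b)%N].
have P0 : exists b, P b.
  by exists 0%N; rewrite /P /=; apply/existsP; exists ord0; rewrite subn0 addn0.
have Pf b : P b -> (b <= f)%N by case/andP.
case: (ex_maxnP P0 Pf) => b /andP[bf /existsP[a /eqP xab]] bmax.
have bf' : (b < f.+1)%N by [].
rewrite (bigD1 a) //= (bigD1 (Ordinal bf')) //=.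
suff -> : last_meeting x (i - a) (a + b) (f - b) by rewrite -addnA leq_addr.
have ai : (a <= i)%N by rewrite -ltnS.
have e : (i - a + (a + b) = i + b)%N by lia.
rewrite /last_meeting e xab eqxx /=; apply/forallP => j; apply/forallP => k.
apply/negP => jk.
suff : P (b + k.+1)%N by move=> /bmax; rewrite addnS ltnNge leq_addr.
have kf : (k < f - b)%N by [].
apply/andP; split; first by lia.
have ji : (i - j < i.+1)%N by lia.
apply/existsP; exists (Ordinal ji) => /=.
have := ltn_ord j; move=> jia.
by rewrite subKn ?addnA //; lia.
Qed.

Section Expectation.
Variables (R : realFieldType) (d : nat).
Hypothesis d0 : (0 < d)%N.
Notation path := (nat -> 'rV[int]_d).
Implicit Types (Q : path -> R) (x : path).

Definition expect (n : nat) (Q : path -> R) : R :=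
  avg n (fun u : seq ('I_d * bool) => Q (walk 0 u)).

(** Stationarity of the increments: a translation invariant function of a window
    of the path has the same mean wherever the window is. *)
Lemma avg_window v s n r Q : pattern_fun n Q ->
  avg (s + n + r) (fun u => Q (fun i => walk v u (s + i))) = expect n Q.
Proof.
move=> pQ; rewrite avg_cat avg_cat /expect -[RHS](avg_const s _ d0).
apply: eq_avg => u su; apply: eq_avg => w sw.
rewrite -[RHS](avg_const r _ d0); apply: eq_avg => z _.
have e k : (k <= n)%N -> walk v ((u ++ w) ++ z) (s + k) = walk v u s + walk 0 w k.
  by move=> kn; rewrite walk_catl ?size_cat ?su ?sw ?leq_add2l // -su walk_catr walk_shift.
by apply: pQ => i j ni nj; rewrite !e // (inj_eq (addrI _)).
Qed.

Lemma expect_le n Q Q' : (forall x, Q x <= Q' x) -> expect n Q <= expect n Q'.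
Proof. by move=> QQ; apply: avg_le => u _. Qed.

Lemma expect_const n (c : R) : expect n (fun=> c) = c.
Proof. exact: avg_const. Qed.

Lemma expect_sum n (I : Type) (r : seq I) (P : pred I) (F : I -> path -> R) :
  expect n (fun x => \sum_(i <- r | P i) F i x) = \sum_(i <- r | P i) expect n (F i).
Proof. exact: avg_sum. Qed.

Lemma expectD n Q Q' : expect n (fun x => Q x + Q' x) = expect n Q + expect n Q'.
Proof. exact: avgD. Qed.

Lemma expectZ n (c : R) Q : expect n (fun x => c * Q x) = c * expect n Q.
Proof. exact: avgZl. Qed.

Lemma expect_window n N s r Q : pattern_fun n Q -> N = (s + n + r)%N ->
  expect N (fun x => Q (fun i => x (s + i)%N)) = expect n Q.
Proof. by move=> pQ ->; exact: avg_window. Qed.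

Lemma expect_return s n r N : N = (s + n + r)%N ->
  expect N (fun x => (x s == x (s + n)%N)%:R) = ret R d n.
Proof.
move=> e; pose Q x : R := (x 0%N == x n)%:R.
have pQ : pattern_fun n Q by move=> x y xy; rewrite /Q xy.
transitivity (expect n Q).
  by rewrite -(expect_window pQ e); apply: eq_avg => u _; rewrite /Q addn0.
rewrite -avg_return_ret; apply: eq_avg => u un.
rewrite /Q walk0 /walk add0r -un take_size.
by rewrite eq_sym.
Qed.

Definition cut_prob (i f : nat) : R := expect (i + f) (fun x => (cut x i f)%:R).

Lemma cut_prob_expect N i f : (i + f <= N)%N ->
  expect N (fun x => (cut x i f)%:R) = cut_prob i f.
Proof.
move=> h; have p : pattern_fun (i + f) (fun x : path => (cut x i f)%:R : R).
  exact/pattern_boolr/pattern_cut.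
by rewrite /cut_prob -(@expect_window _ N 0 (N - (i + f)) _ p) // add0n subnKC.
Qed.

Lemma cut_prob_anti i f i' f' : (i <= i')%N -> (f <= f')%N ->
  cut_prob i' f' <= cut_prob i f.
Proof.
move=> ii ff; have p : pattern_fun (i + f) (fun x : path => (cut x i f)%:R : R).
  exact/pattern_boolr/pattern_cut.
rewrite [leRHS]/cut_prob -(@expect_window _ (i' + f') (i' - i) (f' - f) _ p); last by lia.
apply: expect_le => x; rewrite ler_nat; case h : (cut x i' f') => //.
by rewrite (@cut_window _ x (i' - i) i f f') // subnK.
Qed.

Lemma cut_prob_le1 i f : cut_prob i f <= 1.
Proof.
rewrite -[leRHS](expect_const (i + f)); apply: expect_le => x.
by rewrite lern1 leq_b1.
Qed.

Lemma cut_prob_ge0 i f : 0 <= cut_prob i f.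
Proof.
rewrite -[leLHS](expect_const (i + f)); apply: expect_le => x.
by rewrite ler0n.
Qed.

(** Deleting the loop between the two times turns the event into a cut at time j,
    and the loop is independent of the rest. *)
Lemma last_meeting_prob j n f :
  expect (j + n + f) (fun x => (last_meeting x j n f)%:R) = ret R d n * cut_prob j f.
Proof.
pose tail_cut u : R := avg f (fun z : seq ('I_d * bool) => (cut (walk 0 (u ++ z)) j f)%:R).
transitivity (avg j (fun u => avg n (fun w =>
    tail_cut u * (\sum_(s <- w) @stepv d s == 0)%:R))).
  rewrite /expect !avg_cat; apply: eq_avg => u su; apply: eq_avg => w sw.
  rewrite mulrC -avgZl; apply: eq_avg => z sz.
  rewrite -natrM mulnb; congr (nat_of_bool _)%:R.
  have ej : walk 0 ((u ++ w) ++ z) j = walk 0 u j.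
    by rewrite -catA walk_catl ?su.
  have ejn k : walk 0 ((u ++ w) ++ z) (j + n + k) =
      walk (walk 0 u j + \sum_(s <- w) @stepv d s) z k.
    rewrite -{1}su -{1}sw -size_cat walk_catr size_cat su sw -{1}su walk_catr su.
    by rewrite {2}/walk -sw take_size.
  have ejk k : walk 0 (u ++ z) (j + k) = walk (walk 0 u j) z k.
    by rewrite -su walk_catr.
  rewrite /last_meeting ej -[(j + n)%N in X in _ == X]addn0 ejn walk0.
  rewrite -[X in X == _]addr0 (inj_eq (addrI _)) eq_sym.
  case: eqP => //= w0; rewrite w0 addr0 in ejn.
  apply/forallP/cutP => [h j' k jj' jk|h j'].
    have kf : (k - j.+1 < f)%N by lia.
    have j'l : (j' < j.+1)%N by [].
    have /forallP/(_ (Ordinal kf))/eqP := h (Ordinal j'l).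
    rewrite /= ejn -catA walk_catl ?su // walk_catl ?su //.
    by rewrite -ejk; congr (_ <> walk _ _ _); lia.
  apply/forallP => k; apply/eqP.
  have j'j : (j' <= j)%N by rewrite -ltnS.
  rewrite ejn -catA walk_catl ?su // -[walk 0 u j' ](@walk_catl _ _ u z) ?su //.
  rewrite -ejk; apply: h => //.
  by have := ltn_ord k; lia.
rewrite /cut_prob /expect avg_cat -avgZl; apply: eq_avg => u su.
by rewrite avgZl avg_return_ret mulrC.
Qed.

End Expectation.

(** * Density of cut times and number of meetings *)

Lemma sum_rect_le (R : realFieldType) (F : nat -> R) (A B : nat) :
  (forall n, 0 <= F n) ->
  \sum_(a < A) \sum_(b < B) F (a + b)%N <= \sum_(n < A + B) n.+1%:R * F n.
Proof.
move=> F0.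
apply: (@le_trans _ _ (\sum_(a < A) \sum_(n < A + B) (a <= n)%:R * F n)).
  apply: ler_sum => a _.
  rewrite -(big_mkord xpredT (fun b => F (a + b)%N)).
  rewrite -(big_mkord xpredT (fun n => (a <= n)%:R * F n)).
  have aA := ltn_ord a.
  rewrite [leRHS](@big_cat_nat _ _ _ a) //=; last by lia.
  rewrite [X in _ <= _ + X](@big_cat_nat _ _ _ (a + B)) //=; [|lia|lia].
  have -> : \sum_(a <= n < a + B) (a <= n)%:R * F n = \sum_(0 <= b < B) F (a + b)%N.
    rewrite -{1}[nat_of_ord a]add0n big_addn addKn; apply: eq_bigr => b _.
    by rewrite leq_addl mul1r addnC.
  rewrite addrCA lerDl addr_ge0 // sumr_ge0 // => n _; by rewrite mulr_ge0.
rewrite exchange_big /=; apply: ler_sum => n _; rewrite -mulr_suml.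
apply: ler_wpM2r => //; rewrite -natr_sum ler_nat.
move: (nat_of_ord n) => {}n; apply: leq_trans (geq_minr A _).
elim: (A) => [|a IH]; first by rewrite big_ord0.
by rewrite big_ord_recr /=; case: (leqP a n) => h; lia.
Qed.

Lemma leq_bool (b c : bool) : (b -> c) -> (b <= c)%N.
Proof. by case: b => // ->. Qed.

Section GoodPaths.
Variable R : realFieldType.

(** The horizon H is common to all times, so that a time i has a future of
    length H - i. *)
Definition cut_count (T : eqType) (x : nat -> T) (n H : nat) : nat :=
  \sum_(i < n) cut x i (H - i).

Definition dense_cuts (theta : R) (T : eqType) (x : nat -> T) (H : nat) : bool :=
  [forall n : 'I_H.+1, theta * n%:R <= (cut_count x n H)%:R].

Lemma pattern_dense_cuts theta (T : eqType) (N H : nat) : (H <= N)%N ->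
  pattern_fun N (fun x : nat -> T => dense_cuts theta x H).
Proof.
move=> HN x y xy; apply: eq_forallb => n; congr (_ <= _%:R); apply: eq_bigr => i _.
by rewrite (@pattern_cut _ N i (H - i) _ x y xy) //; have := ltn_ord i; have := ltn_ord n; lia.
Qed.

(** Greedy covering: from the left, skip one place where E fails, and the whole
    interval of length n where E holds.  The skipped intervals are disjoint, and
    each carries at least lam times its length. *)
Lemma covering (f : nat -> R) (E : nat -> bool) (lam : R) (M N : nat) :
  0 <= lam -> (forall i, 0 <= f i) ->
  (forall s, (s < M)%N -> E s -> exists n, [/\ (0 < n)%N, (n <= N)%N &
     lam * n%:R <= \sum_(s <= i < s + n) f i]) ->
  lam * (\sum_(0 <= s < M) E s)%:R <= \sum_(0 <= i < M + N) f i.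
Proof.
move=> lam0 f0 h.
suff H k s : (M - s <= k)%N -> (s <= M + N)%N ->
    lam * (\sum_(s <= t < M) E t)%:R <= \sum_(s <= i < M + N) f i.
  by apply: (H M); rewrite ?subn0 ?leq0n.
have pos a b : 0 <= \sum_(a <= i < b) f i by apply: sumr_ge0.
elim: k s => [|k IH] s Mk sMN.
  by rewrite big_geq ?mulr0 //; lia.
have [Ms|sM] := leqP M s; first by rewrite big_geq ?mulr0.
case Es : (E s); last first.
  rewrite big_ltn // Es add0n; apply: le_trans (IH s.+1 _ _) _; [lia|lia|].
  by rewrite [leRHS]big_ltn ?lerDr //; lia.
have [n [n0 nN hn]] := h s sM Es.
rewrite [leRHS](@big_cat_nat _ _ _ (s + n)) //=; [|lia|lia].
apply: (@le_trans _ _ (lam * n%:R + lam * (\sum_(s + n <= t < M) E t)%:R)).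
  rewrite -mulrDr -natrD; apply: ler_wpM2l => //; rewrite ler_nat.
  have [sn|/ltnW sn] := leqP (s + n) M.
    rewrite (@big_cat_nat _ _ _ (s + n)) //=; last lia.
    rewrite leq_add2r; apply: (@leq_trans (\sum_(s <= i < s + n) 1)%N).
      by apply: leq_sum => i _; rewrite leq_b1.
    by rewrite sum_nat_const_nat addKn muln1.
  rewrite [X in (_ <= _ + X)%N]big_geq // addn0.
  apply: (@leq_trans (\sum_(s <= i < M) 1)%N).
    by apply: leq_sum => i _; rewrite leq_b1.
  by rewrite sum_nat_const_nat muln1; lia.
by apply: lerD => //; apply: IH; lia.
Qed.

(** A window of a path has more cut times than the path itself, so whenever the
    window starting at s violates density, the path has at least a proportion
    1 - theta of non-cut times on some interval starting at s: the situation of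
    [covering]. *)
Lemma dense_cuts_window (theta : R) (T : eqType) (x : nat -> T) (M H : nat) : 0 <= theta -> theta <= 1 ->
  (1 - theta) * (\sum_(0 <= s < M) ~~ dense_cuts theta (fun t : nat => x (s + t)%N) H)%:R <=
  \sum_(0 <= i < M + H) (1 - (cut x i (M + H - i))%:R).
Proof.
move=> t0 t1; apply: (@covering (fun i => 1 - (cut x i (M + H - i))%:R)
  (fun s => ~~ dense_cuts theta (fun t : nat => x (s + t)%N) H)).
- by rewrite subr_ge0.
- by move=> i; rewrite subr_ge0 lern1 leq_b1.
move=> s sM; rewrite negb_forall => /existsP[n]; rewrite -ltNge => hn.
exists n; split.
- by case: n hn => -[] //= _; rewrite mulr0 /cut_count big_ord0 ltxx.
- by rewrite -ltnS.
rewrite -{1}[s]add0n big_addn addKn big_mkord.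
have nH : (n <= H)%N by rewrite -ltnS.
apply: (@le_trans _ _ (\sum_(i < n) (1 - (cut (fun t => x (s + t)%N) i (H - i))%:R))).
  rewrite sumrB sumr_const card_ord -natr_sum mulrBl mul1r.
  by apply: lerB => //; exact: ltW.
apply: ler_sum => i _; apply: lerB => //; rewrite ler_nat addnC.
case h : (cut x (s + i) _) => //.
rewrite (@cut_window _ x s i (H - i) (M + H - (s + i))) //; lia.
Qed.

(** Coincidences are counted with multiplicity, which makes the mean additive.
    The distinct places they visit are at most as many, see [size_le_meetings]. *)
Definition meetings (T : eqType) (x : nat -> T) (m f : nat) : nat :=
  \sum_(j < m) \sum_(k < f) (x j == x (m + k.+1)%N).

Lemma pattern_meetings (T : eqType) (N m f : nat) : (m + f <= N)%N ->
  pattern_fun N (fun x : nat -> T => meetings x m f).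
Proof.
move=> mf x y xy; apply: eq_bigr => j _; apply: eq_bigr => k _.
by rewrite xy //; have := ltn_ord j; have := ltn_ord k; lia.
Qed.

Lemma meetings_window (T : eqType) (x : nat -> T) (s m f : nat) :
  (meetings (fun t => x (s + t)) m f <= meetings x (s + m) f)%N.
Proof.
rewrite /meetings -(big_mkord xpredT (fun j => \sum_(k < f) (x j == x (s + m + k.+1)%N))%N).
rewrite (@big_cat_nat _ _ _ s) //=; last exact: leq_addr.
apply: leq_trans (leq_addl _ _).
rewrite -{3}[s]add0n big_addn addKn big_mkord.
apply: eq_leq; apply: eq_bigr => j _; apply: eq_bigr => k _.
by rewrite addnC addnA.
Qed.

(** With c = theta^2 this bounds the number of wrong candidates for the source
    among the first H positions, see [source_like_meetings]. *)
Definition false_count (c : R) (T : eqType) (x : nat -> T) (H : nat) : nat :=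
  \sum_(m < H) (c * m.+1%:R <= (meetings x m.+1 H)%:R)%R.

Lemma pattern_false_count (c : R) (T : eqType) (N H : nat) : (H + H <= N)%N ->
  pattern_fun N (fun x : nat -> T => false_count c x H).
Proof.
move=> HN x y xy; apply: eq_bigr => m _.
by rewrite (@pattern_meetings _ N m.+1 H _ x y xy) //; have := ltn_ord m; lia.
Qed.

Lemma count_multiples_le (c J : R) (H : nat) : 0 < c -> 0 <= J ->
  c * (\sum_(m < H) (c * m.+1%:R <= J)%R)%:R <= J.
Proof.
move=> c0 J0; elim: H => [|H IH]; first by rewrite big_ord0 mulr0.
rewrite big_ord_recr /=; case: (boolP (c * H.+1%:R <= J)) => h; last by rewrite addn0.
apply: le_trans h; rewrite ler_pM2l // ler_nat addn1 ltnS.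
rewrite -[leqRHS]card_ord -sum1_card; apply: leq_sum => i _; exact: leq_b1.
Qed.

(** By [source_like_few] the second condition leaves at most K candidates for the
    source. *)
Definition good (theta : R) (K : nat) (T : eqType) (x : nat -> T) (H : nat) : bool :=
  dense_cuts theta x H && (false_count (theta ^+ 2) x H < K)%N.

Lemma pattern_good theta K (T : eqType) (H : nat) :
  pattern_fun (H + H) (fun x : nat -> T => good theta K x H).
Proof.
move=> x y xy; rewrite /good (@pattern_dense_cuts theta _ (H + H) H _ x y xy) ?leq_addr //.
by rewrite (@pattern_false_count _ _ (H + H) H _ x y xy).
Qed.

End GoodPaths.

Section GoodEvent.
Variables (R : realType) (d : nat).
Hypothesis d0 : (0 < d)%N.
Notation path := (nat -> 'rV[int]_d).
Implicit Types (x : path).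
Variable B : R.
Hypothesis greenB : forall M, green R d M <= B.

Lemma green_bound_ge1 : 1 <= B.
Proof.
apply: le_trans (greenB 1); rewrite /green big_ord_recl big_ord0 ret0.
by rewrite addr0 mulr1.
Qed.

Let B1 := green_bound_ge1.
Let B0 : 0 < B. Proof. exact: lt_le_trans B1. Qed.

(** Decompose at the last meeting around the time i + n0.  The loops shorter than
    n0 leave a past of at least i and a future of at least f, so each contributes
    at most its return probability times [cut_prob i f]; the longer loops
    contribute a tail of the series. *)
Lemma cut_prob_green (i f n0 : nat) : exists N,
  (n0 <= N)%N /\ 1 <= green R d n0 * cut_prob R d i f + (green R d N - green R d n0).
Proof.
pose i' := (i + n0)%N; pose f' := (n0 + f)%N.
exists (i'.+1 + f'.+1)%N; split; first by rewrite /i'; lia.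
pose F n : R := ret R d n * (if (n < n0)%N then cut_prob R d i f else 1).
have F0 n : 0 <= F n.
  by rewrite mulr_ge0 ?ret_ge0 //; case: ifP => // _; exact: cut_prob_ge0.
(* A meeting of the times i' - a <= i' <= i' + b is a loop of length a + b. *)
apply: (@le_trans _ _ (\sum_(a < i'.+1) \sum_(b < f'.+1) F (a + b)%N)).
  rewrite -(expect_const d0 (i' + f') (1 : R)).
  apply: (@le_trans _ _ (expect (i' + f') (fun x => \sum_(a < i'.+1) \sum_(b < f'.+1)
     (last_meeting x (i' - a) (a + b) (f' - b))%:R))).
    apply: expect_le => x; under eq_bigr => a _ do rewrite -natr_sum.
    by rewrite -natr_sum (ler_nat R 1) last_meeting_exists.
  rewrite expect_sum; apply: ler_sum => a _; rewrite expect_sum; apply: ler_sum => b _.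
  have ai : (a <= i')%N by rewrite -ltnS.
  have bf : (b <= f')%N by rewrite -ltnS.
  have -> : (i' + f' = (i' - a) + (a + b) + (f' - b))%N by lia.
  rewrite last_meeting_prob //; apply: ler_wpM2l; first exact: ret_ge0.
  case: ifP => abn; last exact: cut_prob_le1.
  move: (nat_of_ord a) (nat_of_ord b) abn {ai bf} => a' b' abn.
  by apply: cut_prob_anti => //; rewrite /i' /f'; lia.
apply: le_trans (sum_rect_le _ _ F0) _.
set N := (_ + _)%N.
have nN : (n0 <= N)%N by rewrite /N /i'; lia.
have greenE M : green R d M = \sum_(0 <= n < M) n.+1%:R * ret R d n.
  by rewrite big_mkord.
rewrite !greenE -(big_mkord xpredT (fun n => n.+1%:R * F n)).
rewrite (@big_cat_nat _ _ _ n0) //= [\sum_(0 <= n < N) _](@big_cat_nat _ _ _ n0) //=.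
rewrite [X in _ <= _ + X]addrC addKr mulr_suml; apply: lerD; apply: ler_sum_nat => n /andP[h1 h2].
  by rewrite /F h2 mulrA.
by rewrite /F ltnNge h1 mulr1.
Qed.

(** By [cut_prob_green] the mean number of last meetings, which is at least 1,
    is at most B times the probability of a cut, up to a tail that vanishes as
    n0 grows. *)
Lemma cut_prob_ge (i f : nat) : 1 <= B * cut_prob R d i f.
Proof.
pose S := [set green R d M | M in [set: nat]].
have S0 : has_sup S.
  split; first by exists (green R d 0), 0%N.
  by exists B => _ [M _ <-].
have c0 : 0 <= cut_prob R d i f by exact: cut_prob_ge0.
apply/ler_addgt0Pr => e e0.
have [_ [n0 _ <-] Sn0] := sup_adherent e0 S0.
have [N [nN h]] := cut_prob_green i f n0.
have SN : green R d N <= sup S by apply: sup_upper_bound => //; exists N.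
have h2 : green R d n0 * cut_prob R d i f <= B * cut_prob R d i f.
  by apply: ler_wpM2r.
by lra.
Qed.

(** The maximal ergodic inequality for the indicator of non-cut times, obtained by
    averaging [dense_cuts_window] over a path of length M + H: by stationarity the
    left side is M times the probability sought, and the boundary effect H
    disappears as M goes to infinity. *)
Lemma not_dense_cuts_prob (theta : R) (H : nat) : 0 <= theta -> theta < 1 ->
  (1 - theta) * expect H (fun x => (~~ dense_cuts theta x H)%:R) <= 1 - B^-1.
Proof.
move=> t0 t1; set q := expect _ _.
have q_ge M : (1 - theta) * (M%:R * q) <= (M + H)%:R * (1 - B^-1).
  have := expect_le (M + H) (fun x => dense_cuts_window x M H t0 (ltW t1)).
  rewrite expectZ.
  have -> : expect (M + H) (fun x => (\sum_(0 <= s < M) ~~ dense_cuts theta (fun t : nat => x (s + t)%N) H)%:R) = M%:R * q.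
    have -> : (fun x => (\sum_(0 <= s < M) ~~ dense_cuts theta (fun t : nat => x (s + t)%N) H)%:R : R) =
       (fun x => \sum_(0 <= s < M) (~~ dense_cuts theta (fun t : nat => x (s + t)%N) H)%:R).
      by apply/funext => x; rewrite natr_sum.
    rewrite expect_sum (@eq_big_nat _ _ _ _ _ _ (fun=> q)) => [|s /andP[_ sM]].
      by rewrite sumr_const_nat subn0 mulr_natl.
    apply: (@expect_window _ _ d0 H _ s (M - s) (fun x => (~~ dense_cuts theta x H)%:R)).
      by apply: pattern_boolr => x y xy; rewrite (@pattern_dense_cuts _ theta _ H H _ x y).
    by lia.
  move=> h; apply: le_trans h _.
  have -> : (fun x => \sum_(0 <= i < M + H) (1 - (cut x i (M + H - i))%:R) : R) =
      (fun x => \sum_(i < M + H) (1 + (-1) * (cut x i (M + H - i))%:R)).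
    by apply/funext => x; rewrite big_mkord; apply: eq_bigr => i _; rewrite mulN1r.
  rewrite expect_sum -[X in X%:R * _]card_ord mulr_natl -sumr_const; apply: ler_sum => i _.
  rewrite expectD expectZ expect_const // cut_prob_expect; [|by []|by have := ltn_ord i; lia].
  rewrite mulN1r lerD2l lerN2 -[B^-1]mulr1 ler_pdivrMl //.
  exact: cut_prob_ge.
rewrite leNgt; apply/negP => hlt.
set a := (1 - theta) * q in hlt; set b := 1 - B^-1 in hlt q_ge.
have b0 : 0 <= b by rewrite subr_ge0 invf_le1.
have ab : 0 < a - b by rewrite subr_gt0.
(* M large enough for M * a <= (M + H) * b to fail. *)
pose M := (Num.truncn (H%:R * b / (a - b))).+1.
have hM : H%:R * b / (a - b) < M%:R by rewrite /M; exact: truncnS_gt.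
have := q_ge M; rewrite mulrCA -/a natrD mulrDl -lerBlDl -mulrBr.
by rewrite ltr_pdivrMr // in hM; rewrite leNgt hM.
Qed.

(** A coincidence of times at distance n has probability [ret d n], and at most
    n - 1 such pairs surround the time m strictly. *)
Lemma expect_meetings (m f N : nat) : (m + f <= N)%N ->
  expect N (fun x => (meetings x m f)%:R) <= B - 1.
Proof.
move=> mfN.
have -> : expect N (fun x => (meetings x m f)%:R) =
    \sum_(a < m) \sum_(b < f) ret R d (a + b).+2.
  have -> : (fun x => (meetings x m f)%:R : R) =
     (fun x => \sum_(j < m) \sum_(k < f) (x j == x (m + k.+1)%N)%:R).
    apply/funext => x; rewrite natr_sum; apply: eq_bigr => j _.
    by rewrite natr_sum.
  rewrite expect_sum (reindex_inj rev_ord_inj) /=; apply: eq_bigr => a _.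
  rewrite expect_sum; apply: eq_bigr => k _.
  have am := ltn_ord a; have kf := ltn_ord k.
  have e : (m + k.+1 = (m - a.+1) + (a + k).+2)%N by lia.
  by rewrite e (@expect_return _ _ d0 _ _ (N - (m + k.+1))) //; lia.
apply: le_trans (@sum_rect_le _ (fun n => ret R d n.+2) m f _) _.
  by move=> n; exact: ret_ge0.
rewrite lerBrDl; apply: le_trans (greenB (m + f).+2).
rewrite /green big_ord_recl ret0 mulr1 lerD2l big_ord_recl /= ret1 mulr0 add0r.
apply: ler_sum => n _; apply: ler_wpM2r; first exact: ret_ge0.
by rewrite ler_nat /bump /= !add1n; lia.
Qed.

(** By stationarity the time m + 1 may be moved to H, which only adds to the
    past; then all the thresholds c, 2c, 3c, .. apply to the single variable
    [meetings x H H], which passes at most [meetings x H H] / c of them. *)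
Lemma expect_false_count (c : R) (H : nat) : 0 < c ->
  c * expect (H + H) (fun x => (false_count c x H)%:R) <= B - 1.
Proof.
move=> c0; apply: le_trans (expect_meetings (leqnn (H + H))).
pose Y x : R := \sum_(m < H) (c * m.+1%:R <= (meetings x H H)%:R)%R%:R.
apply: (@le_trans _ _ (c * expect (H + H) Y)).
  apply: ler_wpM2l; first exact: ltW.
  have -> : (fun x => (false_count c x H)%:R : R) =
     (fun x => \sum_(m < H) (c * m.+1%:R <= (meetings x m.+1 H)%:R)%R%:R).
    by apply/funext => x; rewrite natr_sum.
  rewrite /Y !expect_sum; apply: ler_sum => m _.
  have mH := ltn_ord m.
  pose Q x : R := (c * m.+1%:R <= (meetings x m.+1 H)%:R)%R%:R.
  have pQ : pattern_fun (m.+1 + H) Q.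
    by move=> x y xy; rewrite /Q (@pattern_meetings _ (m.+1 + H) m.+1 H _ x y xy).
  have -> : expect (H + H) Q = expect (m.+1 + H) Q.
    by rewrite -[RHS](@expect_window _ _ d0 _ (H + H) 0 (H - m.+1)) //; lia.
  rewrite -(@expect_window _ _ d0 _ (H + H) (H - m.+1) 0 Q) //; last by lia.
  apply: expect_le => x; rewrite ler_nat /Q.
  apply: leq_bool => h; rewrite (le_trans h) // ler_nat.
  by apply: leq_trans (meetings_window x (H - m.+1) m.+1 H) _; rewrite subnK.
rewrite -expectZ; apply: expect_le => x; rewrite /Y -natr_sum.
exact: count_multiples_le.
Qed.

(** A union bound over the two ways of failing, with Markov's inequality for the
    number of wrong candidates. *)
Lemma good_prob (theta : R) (K H : nat) : 0 < theta -> theta < 1 -> (0 < K)%N ->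
  1 - (1 - B^-1) / (1 - theta) - (B - 1) / (theta ^+ 2 * K%:R) <=
  expect (H + H) (fun x => (good theta K x H)%:R).
Proof.
move=> t0 t1 K0; have t1' : 0 < 1 - theta by rewrite subr_gt0.
have K0' : 0 < K%:R :> R by rewrite ltr0n.
have h1 : expect (H + H) (fun x => (~~ dense_cuts theta x H)%:R) <= (1 - B^-1) / (1 - theta).
  rewrite ler_pdivlMr // mulrC; apply: le_trans (not_dense_cuts_prob H (ltW t0) t1).
  apply: ler_wpM2l; first exact: ltW.
  apply: le_of_eq; apply: (@expect_window _ _ d0 H _ 0 H (fun x => (~~ dense_cuts theta x H)%:R)) => //.
  by apply: pattern_boolr => x y xy; rewrite (@pattern_dense_cuts _ theta _ H H _ x y).
have h2 : expect (H + H) (fun x => (K <= false_count (theta ^+ 2) x H)%:R) <=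
    (B - 1) / (theta ^+ 2 * K%:R).
  rewrite ler_pdivlMr ?mulr_gt0 ?exprn_gt0 // mulrC -mulrA -expectZ.
  apply: le_trans (expect_false_count H (exprn_gt0 2 t0)).
  apply: ler_wpM2l; first by rewrite exprn_ge0 ?ltW.
  apply: expect_le => x; rewrite -natrM ler_nat.
  by case: (leqP K (false_count (theta ^+ 2) x H)) => h; rewrite ?muln1 ?muln0.
rewrite -[X in X - _ - _](expect_const d0 (H + H) (1 : R)) -addrA -opprD lerBlDr.
apply: (@le_trans _ _ (expect (H + H) (fun x => (good theta K x H)%:R +
   ((~~ dense_cuts theta x H)%:R + (K <= false_count (theta ^+ 2) x H)%:R)))).
  apply: expect_le => x; rewrite -!natrD (ler_nat R 1) /good ltnNge.
  by case: dense_cuts => //; case: (leqP K (false_count (theta ^+ 2) x H)).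
by rewrite !expectD lerD2l lerD.
Qed.

End GoodEvent.

(** * Recognising the source from pockets *)

Section SourceLike.
Variables (R : realType) (d : nat).
Notation point := ('rV[int]_d).
Implicit Types (G : subgraph d) (F : seq point) (x y : point).

(** F is a union of finite components of the graph with y removed. *)
Definition pocket G F y : Prop :=
  y \notin F /\ forall a b, a \in F -> edges G [set a; b] -> b \in y :: F.

(** Pockets around x that grow at most linearly, with distinct exits; when theta
    is positive, those of index 0 are reduced to x.  The quantifiers range over
    countable types, which makes the property measurable in G. *)
Definition source_like (theta : R) G x : Prop :=
  vertices G x /\
  forall k : nat, exists l : seq (point * seq point),
    [/\ size l = k.+1, uniq [seq p.1 | p <- l] &
      forall p, p \in l ->
        [/\ x \in p.2, theta * (size p.2).-1%:R <= k%:R & pocket G p.2 p.1]].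

Definition final_cut (w : nat -> point) (i : nat) : bool :=
  `[< forall j k, (j <= i)%N -> (i < k)%N -> w j <> w k >].

Definition final_cut_count (w : nat -> point) (n : nat) : nat :=
  \sum_(i < n) final_cut w i.

Lemma final_cutP (w : nat -> point) i :
  reflect (forall j k, (j <= i)%N -> (i < k)%N -> w j <> w k) (final_cut w i).
Proof. exact: asboolP. Qed.

Lemma cut_anti (T : eqType) (w : nat -> T) i f g : (f <= g)%N -> cut w i g -> cut w i f.
Proof. by move=> fg h; apply: (@cut_window _ w 0 i f g). Qed.

(** A coincidence that prevents i from being a final cut time is visible at a
    finite horizon. *)
Lemma final_cut_horizon (w : nat -> point) (n : nat) :
  exists H, (n <= H)%N /\ forall i, (i < n)%N -> cut w i (H - i) -> final_cut w i.
Proof.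
elim: n => [|n [H [nH IH]]]; first by exists 0%N.
case: (pselect (final_cut w n)) => [cn|ncn].
  exists H.+1; split => // i; rewrite ltnS leq_eqVlt => /orP[/eqP -> //|iltn] h.
  by apply: IH => //; apply: cut_anti h; lia.
have [j [k [jn nk jk]]] : exists j k, [/\ (j <= n)%N, (n < k)%N & w j = w k].
  apply: contrapT => h; apply: ncn; apply/final_cutP => j k jn nk jk.
  by apply: h; exists j, k.
exists (maxn H.+1 k); split; first by lia.
move=> i; rewrite ltnS leq_eqVlt => /orP[/eqP -> |iltn] h.
  by case/cutP/(_ j k jn): h => //; lia.
by apply: IH => //; apply: cut_anti h; lia.
Qed.

Lemma final_cut_uniq (w : nat -> point) (s : seq nat) :
  uniq s -> uniq [seq w t | t <- s & final_cut w t].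
Proof.
move=> us; rewrite map_inj_in_uniq ?filter_uniq // => t t'.
rewrite !mem_filter => /andP[/final_cutP ct _] /andP[/final_cutP ct' _] e.
by case: (ltngtP t t') => // h; [case: (ct t t') | case: (ct' t' t)].
Qed.

Lemma final_cut_uniqS (w : nat -> point) (s : seq nat) :
  uniq s -> uniq [seq w t.+1 | t <- s & final_cut w t].
Proof.
move=> us; rewrite map_inj_in_uniq ?filter_uniq // => t t'.
rewrite !mem_filter => /andP[/final_cutP ct _] /andP[/final_cutP ct' _] e.
by case: (ltngtP t t') => // h; [case: (ct' t.+1 t'.+1) | case: (ct t'.+1 t.+1)].
Qed.

Lemma size_final_cut (w : nat -> point) (n : nat) :
  size [seq t <- iota 0 n | final_cut w t] = final_cut_count w n.
Proof.
rewrite size_filter /final_cut_count -(big_mkord xpredT (fun i => final_cut w i : nat)).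
by rewrite /index_iota subn0 -sum1_count -big_mkcond big_mkcond; apply: eq_bigr.
Qed.

Section GoodTrajectory.
Variables (theta : R) (K : nat) (w : nat -> point).
Hypothesis theta0 : 0 < theta.
Hypothesis w_adj : forall n, lattice_adj (w n : lattice d) (w n.+1).
Hypothesis w_good : forall H, good theta K w H.

Let G : subgraph d := walk_trace (w : trajectory d).

Lemma final_cut_dense n : theta * n%:R <= (final_cut_count w n)%:R.
Proof.
have [H [nH h]] := final_cut_horizon w n.
have nH' : (n < H.+1)%N by [].
have /andP[/forallP/(_ (Ordinal nH')) /= hd _] := w_good H.
apply: le_trans hd _; rewrite ler_nat; apply: leq_sum => i _.
by apply: leq_bool; apply: h.
Qed.

(** The positions at final cut times are distinct and there are infinitely many of
    them. *)
Lemma leaves_finite (F : seq point) (m : nat) : exists n, (m <= n)%N /\ w n \notin F.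
Proof.
apply: contrapT => h.
have hF n : (m <= n)%N -> w n \in F.
  by move=> mn; apply: contrapT => /negP nF; apply: h; exists n.
(* By time N there are more than m + size F cut times. *)
pose N := (Num.truncn ((m + size F)%:R / theta)).+1.
have hN : (m + size F)%:R < theta * N%:R.
  by rewrite mulrC -ltr_pdivrMr //; exact: truncnS_gt.
have := lt_le_trans hN (final_cut_dense N); rewrite ltr_nat; apply/negP; rewrite -leqNgt.
rewrite -size_final_cut.
apply: (@leq_trans (size (iota 0 m) + size [seq t <- iota m (N - m) | final_cut w t])).
  rewrite size_iota; case: (leqP m N) => [mN|Nm].
    rewrite -{1}(subnKC mN) iotaD filter_cat size_cat add0n leq_add2r.
    by rewrite size_filter; apply: leq_trans (count_size _ _) _; rewrite size_iota.
  rewrite size_filter; apply: leq_trans (count_size _ _) _; rewrite size_iota; lia.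
rewrite size_iota leq_add2l -(size_map w).
apply: uniq_leq_size; first exact/final_cut_uniq/iota_uniq.
move=> y /mapP[t]; rewrite mem_filter mem_iota => /and3P[_ mt _] ->.
exact: hF.
Qed.

Lemma trace_edge n : edges G [set w n; w n.+1].
Proof. by exists n. Qed.

Lemma cut_pocket t : final_cut w t -> pocket G (mkseq w t.+1) (w t.+1).
Proof.
move=> /final_cutP ct; split.
  apply/negP => /mapP[j]; rewrite mem_iota add0n ltnS => /andP[_ jt] e.
  by case: (ct j t.+1).
move=> a b aF [n [_ e]].
have inF j : (j <= t)%N -> w j \in mkseq w t.+1.
  by move=> jt; apply/mapP; exists j => //; rewrite mem_iota add0n ltnS.
have nF j : (t < j)%N -> w j \notin mkseq w t.+1.
  move=> tj; apply/negP => /mapP[i]; rewrite mem_iota add0n ltnS => /andP[_ it] ee.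
  by case: (ct i j).
have ha : [set a; b] a by left.
have hb : [set a; b] b by right.
rewrite e in ha hb.
have nt : (n <= t)%N.
  rewrite leqNgt; apply/negP => tn.
  case: ha => ha; move: aF; rewrite ha; apply/negP; apply: nF => //; lia.
rewrite inE; case: hb => ->; first by rewrite inF ?orbT.
move: nt; rewrite leq_eqVlt => /orP[/eqP ->|nt]; first by rewrite eqxx.
by rewrite inF ?orbT.
Qed.

(** Take the first k + 1 final cut times.  The last of them, t, satisfies
    theta * t <= k by density up to time t, which contains only k of them. *)
Lemma source_like_start : source_like theta G (w 0).
Proof.
split; first by exists 0%N.
move=> k.
have ex : exists n, (k.+1 <= final_cut_count w n)%N.
  exists (Num.truncn (k.+1%:R / theta)).+1.
  rewrite -(ler_nat R); apply: le_trans (final_cut_dense _).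
  by rewrite mulrC -ler_pdivrMr //; apply/ltW/truncnS_gt.
case: (ex_minnP ex) => n hn nmin.
have n0 : (0 < n)%N by case: n hn {nmin} => //; rewrite /final_cut_count big_ord0.
have hk : (final_cut_count w n.-1 <= k)%N.
  by rewrite leqNgt; apply/negP => /nmin; lia.
pose ts := take k.+1 [seq t <- iota 0 n | final_cut w t].
have tsP t : t \in ts -> (t < n)%N /\ final_cut w t.
  by move=> /mem_take; rewrite mem_filter mem_iota add0n => /andP[-> /andP[_ ->]].
exists [seq (w t.+1, mkseq w t.+1) | t <- ts]; split.
- by rewrite size_map size_takel // size_final_cut.
- rewrite -map_comp map_take; apply: take_uniq.
  by apply: (@final_cut_uniqS w); exact: iota_uniq.
- move=> _ /mapP[t /tsP[tn ct] ->] /=; split.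
  + by apply/mapP; exists 0%N.
  + rewrite size_map size_iota; apply: (@le_trans _ _ (theta * n.-1%:R)).
      by rewrite ler_pM2l // ler_nat; lia.
    by apply: le_trans (final_cut_dense _) _; rewrite ler_nat.
  + exact: cut_pocket.
Qed.

Lemma size_le_meetings (s : seq point) (m f : nat) : uniq s ->
  (forall y, y \in s -> exists j i, [/\ (j < m)%N, (i < f)%N, w j = y & w (m + i.+1)%N = y]) ->
  (size s <= meetings w m f)%N.
Proof.
move=> us h; rewrite -sum1_size big_seq.
apply: (@leq_trans (\sum_(y <- s) \sum_(j < m) \sum_(i < f) ((w j == y) && (w (m + i.+1)%N == y))%N)).
  rewrite [leqRHS]big_seq; apply: leq_sum => y ys.
  have [j [i [jm fi ej ei]]] := h y ys.
  rewrite (bigD1 (Ordinal jm)) //= (bigD1 (Ordinal fi)) //= ej ei eqxx.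
  by rewrite -addnA leq_addr.
rewrite exchange_big; apply: leq_sum => j _; rewrite exchange_big; apply: leq_sum => i _.
case: (eqVneq (w j) (w (m + i.+1)%N)) => [e|ne] /=; last first.
  rewrite big1 // => y _; case: eqP => // ej; case: eqP => // ei.
  by rewrite -ej in ei; rewrite ei eqxx in ne.
under eq_bigr => y _ do rewrite e andbb eq_sym.
rewrite -(big_mkcond (fun y => y == _)) /= sum1_count.
by rewrite count_uniq_mem // leq_b1.
Qed.

(** Some earlier position is outside of the pocket, so the path enters it before
    time m; it leaves it after time m because it leaves every finite set.  Both
    crossings use the exit y. *)
Lemma pocket_meeting m F y : w m \in F -> pocket G F y ->
  (exists2 j, (j < m)%N & w j \notin F) ->
  (exists2 j, (j < m)%N & w j = y) /\ (exists i, w (m + i.+1)%N = y).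
Proof.
move=> mF [yF hF] [j0 j0m j0F]; split.
  pose P j := (j < m)%N && (w j \notin F).
  have exP : exists j, P j by exists j0; rewrite /P j0m.
  have Pm j : P j -> (j <= m)%N by case/andP=> /ltnW.
  case: (ex_maxnP exP Pm) => j /andP[jm jF] jmax.
  exists j => //.
  have j1F : w j.+1 \in F.
    apply: contrapT => /negP h.
    have : (j.+1 < m)%N.
      by rewrite ltn_neqAle jm andbT; apply/eqP => e; rewrite e mF in h.
    by move=> h2; have := jmax j.+1; rewrite /P h h2 ltnn => /(_ isT).
  have := hF (w j.+1) (w j) j1F.
  rewrite setUC => /(_ (trace_edge j)); rewrite inE (negbTE jF) orbF.
  by move/eqP.
have [n [mn nF]] := leaves_finite F m.
have ex : exists n, (m <= n)%N && (w n \notin F) by exists n; rewrite mn.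
case: (ex_minnP ex) => {mn nF}n /andP[mn nF] nmin.
have mn' : (m < n)%N.
  by rewrite ltn_neqAle mn andbT; apply/eqP => e; rewrite -e mF in nF.
exists (n - m.+1)%N.
have -> : (m + (n - m.+1).+1 = n)%N by lia.
have n1F : w n.-1 \in F.
  apply: contrapT => /negP h.
  have := nmin n.-1; rewrite h andbT; have -> : (m <= n.-1)%N by lia.
  by move=> /(_ isT); lia.
have := hF (w n.-1) (w n) n1F; have := trace_edge n.-1.
by rewrite prednK; [move=> te /(_ te); rewrite inE (negbTE nF) orbF => /eqP | lia].
Qed.

(** Choose k + 1 as the least integer above theta^2 m.  The path up to time m has
    more than theta m places, too many for the pockets of index k, so each of the
    k + 1 exits is visited both before and after time m by [pocket_meeting]. *)
Lemma source_like_meetings m : (0 < m)%N -> source_like theta G (w m) ->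
  exists f, forall H, (f <= H)%N -> theta ^+ 2 * m%:R <= (meetings w m H)%:R.
Proof.
move=> m0 [_ sl].
have c0 : 0 < theta ^+ 2 * m%:R by rewrite mulr_gt0 ?exprn_gt0 ?ltr0n.
(* k + 1 is the least integer that is at least theta^2 m. *)
have [k kc ck] : exists2 k : nat, k%:R < theta ^+ 2 * m%:R & theta ^+ 2 * m%:R <= k.+1%:R.
  have ex : exists k, theta ^+ 2 * m%:R <= k.+1%:R.
    by exists (Num.truncn (theta ^+ 2 * m%:R)); apply/ltW/truncnS_gt.
  case: (ex_minnP ex) => -[|k] hk kmin; first by exists 0%N.
  exists k.+1 => //; rewrite ltNge; apply/negP => /kmin; by rewrite ltnn.
have [l [sl1 sl2 sl3]] := sl k.
have hp p : p \in l -> (exists2 j, (j < m)%N & w j = p.1) /\ (exists i, w (m + i.+1)%N = p.1).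
  move=> /sl3[mF szF pk]; apply: (pocket_meeting mF pk).
  apply: contrapT => h.
  have inF j : (j < m)%N -> w j \in p.2.
    by move=> jm; apply: contrapT => /negP jF; apply: h; exists j.
  have : (final_cut_count w m < size p.2)%N.
    rewrite -size_final_cut -(size_map w).
    apply: (@uniq_leq_size _ (w m :: [seq w t | t <- iota 0 m & final_cut w t])).
      rewrite /= final_cut_uniq ?iota_uniq // andbT; apply/negP => /mapP[t].
      rewrite mem_filter mem_iota add0n => /and3P[/final_cutP ct _ tm] e.
      by case: (ct t m).
    move=> y; rewrite inE => /orP[/eqP -> //|/mapP[t]].
    by rewrite mem_filter mem_iota add0n => /and3P[_ _ tm] ->; exact: inF.
  move=> hsz; have hsz' : (final_cut_count w m <= (size p.2).-1)%N by lia.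
  move: kc; apply/negP; rewrite -leNgt; apply: le_trans szF.
  rewrite expr2 -mulrA ler_pM2l //; apply: le_trans (final_cut_dense m) _.
  by rewrite ler_nat.
have [f hf] : exists f, forall p, p \in l -> exists2 i, (i < f)%N & w (m + i.+1)%N = p.1.
  elim: l hp {sl1 sl2 sl3} => [|p l IH] hp; first by exists 0%N.
  have [f hf] := IH (fun q ql => hp q (mem_behead (s := p :: l) ql)).
  have [_ [i hi]] := hp p (mem_head _ _).
  exists (maxn f i.+1) => q; rewrite inE => /orP[/eqP ->|/hf[i' i'f e]].
    by exists i => //; lia.
  by exists i' => //; lia.
exists f => H fH; apply: le_trans ck _; rewrite ler_nat -sl1 -(size_map fst).
apply: size_le_meetings => // _ /mapP[p pl ->].
have [[j jm ej] _] := hp p pl; have [i fi ei] := hf p pl.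
by exists j, i; split => //; apply: leq_trans fi fH.
Qed.

Lemma source_like_few (s : seq point) :
  uniq s -> (forall x, x \in s -> source_like theta G x) -> (size s <= K)%N.
Proof.
move=> us hs.
pose cand H := w 0 :: [seq w m.+1 | m <- iota 0 H & theta ^+ 2 * m.+1%:R <= (meetings w m.+1 H)%:R].
have [H hH] : exists h, forall H, (h <= H)%N -> forall x, x \in s -> x \in cand H.
  elim: s hs {us} => [|x s IH] hs; first by exists 0%N.
  have [h hh] := IH (fun y ys => hs y (mem_behead (s := x :: s) ys)).
  have slx := hs x (mem_head _ _).
  have [[m _ em] _] := slx; rewrite -em in slx *.
  case: m em slx => [|m] em slx.
    exists h => H hH y; rewrite inE => /orP[/eqP ->|]; first by rewrite inE eqxx.
    exact: hh.
  have [f hf] := source_like_meetings (ltn0Sn m) slx.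
  exists (maxn (maxn h f) m.+1) => H hH y; rewrite inE => /orP[/eqP ->|]; last first.
    by apply: hh; lia.
  rewrite inE; apply/orP; right; apply/mapP; exists m => //.
  rewrite mem_filter mem_iota add0n /= hf; lia.
have := uniq_leq_size us (hH H (leqnn H)); move=> h; apply: leq_trans h _.
have /andP[_] := w_good H; apply: leq_trans; rewrite /= ltnS size_map size_filter.
by rewrite /false_count -(big_mkord xpredT (fun m => (theta ^+ 2 * m.+1%:R <= (meetings w m.+1 H)%:R)%R : nat))
  /index_iota subn0 -sum1_count big_mkcond; apply: leq_sum => i _; case: (_ <= _).
Qed.

End GoodTrajectory.
End SourceLike.

(** * The estimator *)

Lemma countable_bigcap_measurable (disp : measure_display) (T : measurableType disp)
    (I : countType) (F : I -> set T) :
  (forall i, measurable (F i)) -> measurable (\bigcap_i F i).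
Proof.
move=> mF; rewrite -[X in measurable X]setCK setC_bigcap; apply: measurableC.
apply: countable_bigcupT_measurable => [|i]; first exact: countableP.
exact/measurableC/mF.
Qed.

Lemma countable_bigcup_measurable (disp : measure_display) (T : measurableType disp)
    (I : countType) (F : I -> set T) :
  (forall i, measurable (F i)) -> measurable (\bigcup_i F i).
Proof. by apply: countable_bigcupT_measurable; exact: countableP. Qed.

Lemma measurable_if_prop (disp : measure_display) (T : measurableType disp)
    (P : Prop) (A : set T) : (P -> measurable A) -> measurable [set t | P /\ A t].
Proof.
move=> mA; case: (pselect P) => p.
  by rewrite (_ : mkset _ = A); [exact: mA | apply/seteqP; split => [t []|t]].
by rewrite (_ : mkset _ = set0) //; apply/seteqP; split => [t []|t].
Qed.

Section Estimator.
Variables (R : realType) (d : nat) (theta : R).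
Notation point := ('rV[int]_d).

Lemma measurable_pocket (F : seq point) (y : point) :
  measurable [set G : graph_space d | pocket G F y].
Proof.
apply: measurable_if_prop => _.
rewrite [X in measurable X](_ : _ = \bigcap_(p : point * point)
   (~` [set G : graph_space d | (p.1 \in F /\ p.2 \notin y :: F) /\ edges G [set p.1; p.2]])).
  apply: countable_bigcap_measurable => p; apply: measurableC.
  apply: measurable_if_prop => _.
  by apply: sub_gen_smallest; right; exists p.1, p.2.
apply/seteqP; split => [G h [a b] _ /= [[aF bF] e]|G h a b aF e].
  by move: bF; rewrite (h _ _ aF e).
by apply: contrapT => /negP bF; apply: (h (a, b) I).
Qed.

Lemma measurable_source_like (x : point) :
  measurable [set G : graph_space d | source_like theta G x].
Proof.
rewrite (_ : mkset _ = [set G : graph_space d | vertices G x] `&` \bigcap_(k : nat)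
  \bigcup_(l : seq (point * seq point)) [set G : graph_space d |
    (size l = k.+1 /\ uniq [seq p.1 | p <- l]) /\
    (\bigcap_(p : point * seq point) (~` [set G : graph_space d | p \in l /\
       (~` [set G : graph_space d | (x \in p.2 /\ theta * (size p.2).-1%:R <= k%:R) /\
          pocket G p.2 p.1]) G])) G]); last first.
  apply/seteqP; split => [G [vx h]|G [vx h]]; split => //.
    move=> k _; have [l [l1 l2 l3]] := h k; exists l => //; split => // p _ /= [pl]; apply.
    by have [] := l3 p pl.
  move=> k; have [l _ [[l1 l2] l3]] := h k I; exists l; split => // p pl.
  have := l3 p I; rewrite /= => h3.
  suff : (x \in p.2 /\ theta * (size p.2).-1%:R <= k%:R) /\ pocket G p.2 p.1 by case=> -[].
  by apply: contrapT => h4; apply: h3.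
apply: measurableI; first by apply: sub_gen_smallest; left; exists x.
apply: countable_bigcap_measurable => k; apply: countable_bigcup_measurable => l.
apply: measurable_if_prop => _; apply: countable_bigcap_measurable => p.
apply: measurableC; apply: measurable_if_prop => _; apply: measurableC.
by apply: measurable_if_prop => _; exact: measurable_pocket.
Qed.

(** Enumerating the lattice makes the counting measure on the candidates a
    countable sum of kernels. *)
Definition mass_at (n : nat) (G : graph_space d) : {measure set (lattice d) -> \bar R} :=
  if @pickle_inv point n is Some x then
    if `[< source_like theta G x >]
    then (dirac (x : lattice d) : {measure set (lattice d) -> \bar R})
    else (mzero : {measure set (lattice d) -> \bar R})
  else (mzero : {measure set (lattice d) -> \bar R}).

Let measurable_mass_at n (U : set (lattice d)) : measurable U ->
  measurable_fun [set: graph_space d] (mass_at n ^~ U).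
Proof.
move=> mU; rewrite /mass_at; case: pickle_inv => [x|]; last exact: measurable_cst.
rewrite (_ : (fun _ => _) = (fun G : graph_space d => if `[< source_like theta G x >]
  then \d_(x : lattice d) U else 0%E)); last by apply/funext => G; case: ifP.
apply: measurable_fun_ifT; [|exact: measurable_cst|exact: measurable_cst].
apply: (measurable_fun_bool true).
rewrite (_ : _ `&` _ = [set G : graph_space d | source_like theta G x]).
  exact: measurable_source_like.
by apply/seteqP; split => [G [_ /asboolP]|G /asboolP].
Qed.

HB.instance Definition _ n :=
  isKernel.Build _ _ _ _ _ (mass_at n) (@measurable_mass_at n).

Definition candidate_kernel : R.-ker graph_space d ~> lattice d :=
  kseries (fun n => mass_at n : R.-ker graph_space d ~> lattice d).

(** The uniform law on the candidates.  When there are none or infinitely many,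
    the normalisation falls back on the point 0. *)
Definition source_estimator : estimator R d :=
  knormalize candidate_kernel (dirac (0 : lattice d)).

Lemma source_estimator_ge (K : nat) (G : graph_space d) (v : point) : (0 < K)%N ->
  source_like theta G v ->
  (forall s : seq point, uniq s -> (forall x, x \in s -> source_like theta G x) ->
     (size s <= K)%N) ->
  ((K%:R^-1)%:E <= source_estimator G [set (v : lattice d)])%E.
Proof.
move=> K0 slv few.
set k := candidate_kernel.
have kT : (k G setT <= K%:R%:E)%E.
  rewrite /k /candidate_kernel /kseries /= /mseries; apply: lime_le.
    by apply: is_cvg_nneseries => n _ _; exact: measure_ge0.
  apply: nearW => n.
  pose c i : option point := if @pickle_inv point i is Some x then
     if `[< source_like theta G x >] then Some x else None else None.
  have cK : ocancel c pickle.
    move=> i; rewrite /c; have := pickle_invK (T := point) i.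
    by case: pickle_inv => //= x <-; case: ifP.
  have -> : (\sum_(0 <= i < n) mass_at i G setT)%E = ((size (pmap c (iota 0 n)))%:R%:E : \bar R).
    have -> : size (pmap c (iota 0 n)) = (\sum_(i <- iota 0 n) isSome (c i))%N.
      by rewrite size_pmap -sum1_count big_mkcond; apply: eq_bigr => i _; case: (c i).
    rewrite natr_sum -sumEFin /index_iota subn0.
    apply: eq_bigr => i _; rewrite /mass_at /c.
    by case: pickle_inv => [x|] //; case: ifP => _ //=; rewrite diracT.
  rewrite lee_fin ler_nat; apply: few; first by rewrite (pmap_uniq cK) ?iota_uniq.
  move=> x; rewrite mem_pmap => /mapP[i _]; rewrite /c.
  by case: pickle_inv => // y; case: ifP => // /asboolP sy [->].
have kv : (1 <= k G [set (v : lattice d)])%E.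
  rewrite /k /candidate_kernel /kseries /= /mseries.
  apply: le_trans (@nneseries_lim_ge _ _ _ _ (pickle v).+1 _); last first.
    by move=> n _ _; exact: measure_ge0.
  rewrite big_nat_recr //=; apply: (@le_trans _ _ (mass_at (pickle v) G [set (v : lattice d)])).
    by rewrite /mass_at pickleK_inv asboolT // /= diracE mem_set.
  by rewrite leeDr // sume_ge0.
rewrite /source_estimator /knormalize /= /mnormalize -/k.
have kT1 : (1 <= k G setT)%E by apply: le_trans kv _; apply: le_measure; rewrite ?inE.
have fT : k G setT \is a fin_num.
  by rewrite ge0_fin_numE ?measure_ge0 //; apply: le_lt_trans kT _; rewrite ltry.
rewrite ifF; last first.
  apply/negbTE; rewrite negb_or; apply/andP; split.
    by apply: contraTneq kT1 => ->; rewrite -ltNge lte01.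
  by apply: contraTneq fT => ->.
rewrite -(fineK fT) lee_fin in kT kT1.
apply: (@le_trans _ _ (1 * (fine (k G setT))^-1%:E)%E).
  by rewrite mul1e lee_fin lef_pV2 ?posrE ?ltr0n // (lt_le_trans ltr01).
by apply: lee_wpmul2r kv; rewrite lee_fin invr_ge0 (le_trans ler01).
Qed.

End Estimator.

(** * Success probability of the estimator *)

Section Steps.
Variable d : nat.
Notation step := ('I_d * bool)%type.

Lemma stepvE (s : step) j : @stepv d s ord0 j = (if j == s.1 then (if s.2 then 1 else -1) else 0).
Proof. by rewrite /stepv !mxE eqxx /=; case: eqP => _; rewrite ?mulr1 ?mulr0. Qed.

Lemma stepv_inj : injective (@stepv d).
Proof.
move=> [i b] [i' b'] /rowP h; have := h i; rewrite !stepvE /= eqxx.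
case: eqP => [<-|_]; last by case: b {h}.
by case: b b' {h} => -[].
Qed.

(** A sum of absolute values of integers is 1 only if one of them is 1 and the
    others vanish. *)
Lemma lattice_adjP (x y : 'rV[int]_d) :
  reflect (exists s, y = x + @stepv d s) (lattice_adj (x : lattice d) y).
Proof.
apply: (iffP eqP) => [h|[s ->]]; last first.
  rewrite (bigD1 s.1) //= big1 => [|i /negbTE si].
    by rewrite !mxE /= opprD addNKr normrN eqxx mulr1 addr0; case: s.2; rewrite ?normrN normr1.
  by rewrite mxE stepvE si addr0 subrr normr0.
have [i hi] : exists i, x ord0 i != y ord0 i.
  apply: contrapT => hn; move: h; rewrite big1 // => i _.
  have -> : x ord0 i = y ord0 i.
    by apply: contrapT => hh; apply: hn; exists i; apply/eqP.
  by rewrite subrr normr0.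
move: h; rewrite (bigD1 i) //=; set S := \sum_(_ | _) _ => h.
have S0 : 0 <= S by apply: sumr_ge0.
have hi1 : 1 <= `|x ord0 i - y ord0 i|.
  by rewrite -gtz0_ge1 normr_gt0 subr_eq0.
have [hS hx] : S = 0 /\ `|x ord0 i - y ord0 i| = 1 by split; lia.
have hS' j : j != i -> x ord0 j = y ord0 j.
  move=> ji; move/eqP: hS; rewrite psumr_eq0 // => /allP/(_ j (mem_index_enum j)).
  by rewrite ji /= normr_eq0 subr_eq0 => /eqP.
exists (i, y ord0 i - x ord0 i == 1); apply/rowP => j.
rewrite mxE stepvE /=; case: eqP => [->|/eqP /hS' ->]; last by rewrite addr0.
change (y ord0 i = x ord0 i + (if y ord0 i - x ord0 i == 1 then 1 else -1)).
by move: (y ord0 i) (x ord0 i) hx => a b hx; case: eqP => e; lia.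
Qed.

Fixpoint words (n : nat) : seq (seq step) :=
  if n is n'.+1 then [seq s :: u | s <- index_enum (step : finType), u <- words n'] else [:: [::]].

Lemma mem_words n u : (u \in words n) = (size u == n).
Proof.
elim: n u => [|n IH] u /=; first by rewrite inE size_eq0.
apply/allpairsP/idP => [[[s u'] [_ /= u'n ->]]|]; first by rewrite /= eqSS -IH.
by case: u => // s u; rewrite eqSS -IH => un; exists (s, u); rewrite mem_index_enum.
Qed.

Lemma words_uniq n : uniq (words n).
Proof.
elim: n => //= n IH; apply: allpairs_uniq => //; first exact: index_enum_uniq.
by move=> [s u] [s' u'] _ _ /= [-> ->].
Qed.

Lemma avg_words (R : realFieldType) n (f : seq step -> R) :
  avg n f = (2 * d)%:R ^- n * \sum_(u <- words n) f u.
Proof.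
elim: n f => [|n IH] f; first by rewrite /= big_seq1 expr0 invr1 mul1r.
rewrite /= exprS invfM -mulrA big_allpairs_dep; congr (_ * _).
by rewrite mulr_sumr; apply: eq_bigr => s _; rewrite IH.
Qed.

Lemma walk_cons v (s : step) u i : walk v (s :: u) i.+1 = walk (v + stepv s) u i.
Proof. by rewrite /walk /= big_cons addrA. Qed.

Lemma walk_inj v (u u' : seq step) : size u = size u' ->
  (forall i, (i <= size u)%N -> walk v u i = walk v u' i) -> u = u'.
Proof.
elim: u u' v => [|s u IH] [|s' u'] v //= [su] h.
have ss : s = s'.
  by have := h 1%N isT; rewrite !walk_cons !walk0 => /addrI /stepv_inj.
rewrite -ss in h *; congr (_ :: _); apply: (IH u' (v + stepv s)) => // i iu.
by have := h i.+1 iu; rewrite !walk_cons.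
Qed.

Lemma walk_adj v (u : seq step) i : (i < size u)%N ->
  lattice_adj (walk v u i : lattice d) (walk v u i.+1).
Proof.
elim: u v i => // s u IH v [|i] iu.
  by apply/lattice_adjP; exists s; rewrite walk_cons !walk0.
by rewrite !walk_cons; apply: IH.
Qed.

Definition cylinder (v : 'rV[int]_d) (u : seq step) : set (trajectory d) :=
  [set w : trajectory d | forall i, (i <= size u)%N -> w i = walk v u i].

Lemma measurable_cylinder_path (n : nat) (x : nat -> 'rV[int]_d) :
  measurable [set w : trajectory d | forall i, (i <= n)%N -> w i = x i].
Proof.
rewrite (_ : mkset _ = \bigcap_(i : nat) [set w : trajectory d | (i <= n)%N -> w i = x i]).
  apply: countable_bigcap_measurable => i; case: (leqP i n) => h.
    rewrite (_ : mkset _ = [set w : trajectory d | w i = x i]).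
      exact: measurable_coordinate.
    by apply/seteqP; split => [w /(_ isT)|w ? _].
  by rewrite (_ : mkset _ = setT) //; apply/seteqP; split.
by apply/seteqP; split => [w h i _|w h i]; [exact: h | exact: h].
Qed.

Lemma measurable_cylinder v u : measurable (cylinder v u).
Proof. exact: measurable_cylinder_path. Qed.

Lemma cylinder_disjoint v u u' : size u = size u' -> u != u' ->
  cylinder v u `&` cylinder v u' = set0.
Proof.
move=> su uu; apply/seteqP; split => // w [h h'].
by move/eqP: uu; apply; apply: (walk_inj su (v := v)) => i iu; rewrite -h // -h' // -su.
Qed.

Section Law.
Variables (R : realType) (v : 'rV[int]_d) (P : probability (trajectory d) R).
Hypothesis srwP : is_srw_law (v : lattice d) P.

Lemma cylinder_prob u : P (cylinder v u) = ((2 * d)%:R ^- size u)%:E.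
Proof.
rewrite /cylinder (srwP (size u) (walk v u)) walk0 eqxx /= ifT //.
by apply/forallP => i; apply: walk_adj.
Qed.

Lemma cylinders_prob n (l : seq (seq step)) : uniq l -> (forall u, u \in l -> size u = n) ->
  P (\bigcup_(u in [set` l]) cylinder v u) = ((2 * d)%:R ^- n * (size l)%:R)%:E.
Proof.
move=> ul ln; rewrite bigcup_seq; elim: l ul ln => [|u l IH] ul ln.
  by rewrite big_nil measure0 mulr0.
rewrite big_cons measureU.
- move: ul => /= /andP[_ ul].
  rewrite IH // => [|u' u'l]; last by apply: ln; rewrite inE u'l orbT.
  by rewrite cylinder_prob (ln u (mem_head _ _)) -EFinD -natr1; congr EFin; ring.
- exact: measurable_cylinder.
- by apply: bigsetU_measurable => u' _; exact: measurable_cylinder.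
- rewrite -bigcup_seq; apply/seteqP; split => // w [wu [u' /= u'l wu']].
  have : (cylinder v u `&` cylinder v u') w by [].
  rewrite cylinder_disjoint //.
    by rewrite (ln u (mem_head _ _)) (ln u') // inE u'l orbT.
  by apply: contraTneq u'l => <-; case/andP: ul.
Qed.

(** Stated through words, so that its probability under the walk is a mean over
    words. *)
Definition path_event (n : nat) (Q : (nat -> 'rV[int]_d) -> bool) : set (trajectory d) :=
  \bigcup_(u in [set` [seq u <- words n | Q (walk v u)]]) cylinder v u.

Lemma measurable_path_event n Q : measurable (path_event n Q).
Proof.
rewrite /path_event bigcup_seq; apply: bigsetU_measurable => u _.
exact: measurable_cylinder.
Qed.

Lemma path_event_prob n (Q : (nat -> 'rV[int]_d) -> bool) : pattern_fun n Q ->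
  P (path_event n Q) = (expect n (fun x => (Q x)%:R))%:E.
Proof.
move=> pQ; rewrite (@cylinders_prob n).
- congr EFin; rewrite /expect avg_words; congr (_ * _).
  rewrite size_filter -sum1_count big_mkcond /= natr_sum big_seq [RHS]big_seq.
  apply: eq_bigr => u _.
  have -> : Q (walk v u) = Q (walk 0 u).
    by apply: pQ => i j _ _; rewrite !(walk_shift v) (inj_eq (addrI _)).
  by case: (Q (walk 0 u)).
- exact/filter_uniq/words_uniq.
- by move=> u; rewrite mem_filter mem_words => /andP[_ /eqP].
Qed.

Lemma path_eventP n (Q : (nat -> 'rV[int]_d) -> bool) (w : trajectory d) : pattern_fun n Q ->
  path_event n Q w ->
  [/\ w 0%N = v, forall i, (i < n)%N -> lattice_adj (w i) (w i.+1) & Q w].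
Proof.
move=> pQ [u /=]; rewrite mem_filter mem_words => /andP[Qu /eqP un] hw; rewrite /cylinder /= un in hw.
split.
- by rewrite hw // walk0.
- by move=> i iltn; rewrite !hw ?(ltnW iltn) //; apply: walk_adj; rewrite un.
- by rewrite -(pQ _ _ _ : Q (walk v u) = _) // => i j hi hj; rewrite !hw.
Qed.

Lemma path_event_prefix n n' (Q Q' : (nat -> 'rV[int]_d) -> bool) : (n <= n')%N ->
  pattern_fun n Q -> (forall x, Q' x -> Q x) -> path_event n' Q' `<=` path_event n Q.
Proof.
move=> nn pQ QQ w [u /=]; rewrite mem_filter mem_words => /andP[Qu /eqP un] hw.
have wt i : (i <= n)%N -> walk v (take n u) i = walk v u i.
  by move=> hi; rewrite /walk take_takel.
exists (take n u) => /=.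
  rewrite mem_filter mem_words size_takel ?un // eqxx andbT.
  by rewrite (pQ _ (walk v u)) ?QQ // => i j hi hj; rewrite !wt.
move=> i; rewrite size_takel ?un // => hi; rewrite wt //; apply: hw; rewrite un; lia.
Qed.

End Law.
End Steps.

Section Success.
Variables (R : realType) (d : nat) (v : 'rV[int]_d).
Hypothesis d0 : (0 < d)%N.
Variable P : probability (trajectory d) R.
Hypothesis srwP : is_srw_law (v : lattice d) P.
Variables (B theta : R).
Hypothesis greenB : forall M, green R d M <= B.
Hypotheses (theta0 : 0 < theta) (theta1 : theta < 1).

Lemma good_anti (K H H' : nat) (x : nat -> 'rV[int]_d) : (H <= H')%N ->
  good theta K x H' -> good theta K x H.
Proof.
move=> HH /andP[/forallP hd hf]; apply/andP; split.
  apply/forallP => n; have nH' : (n < H'.+1)%N by have := ltn_ord n; lia.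
  apply: le_trans (hd (Ordinal nH')) _; rewrite ler_nat; apply: leq_sum => i _.
  by apply: leq_bool; apply: cut_anti; apply: leq_sub2r.
apply: leq_ltn_trans hf; rewrite /false_count.
rewrite -(big_mkord xpredT (fun m => (theta ^+ 2 * m.+1%:R <= (meetings x m.+1 H)%:R)%R : nat)).
rewrite -(big_mkord xpredT (fun m => (theta ^+ 2 * m.+1%:R <= (meetings x m.+1 H')%:R)%R : nat)).
rewrite [leqRHS](@big_cat_nat _ _ _ H) //=; apply: leq_trans (leq_addr _ _).
apply: leq_sum => m _; apply: leq_bool => h; apply: le_trans h _; rewrite ler_nat.
apply: leq_sum => j _.
rewrite -(big_mkord xpredT (fun k => (x j == x (m.+1 + k.+1)%N) : nat)).
rewrite -(big_mkord xpredT (fun k => (x j == x (m.+1 + k.+1)%N) : nat)).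
by rewrite [leqRHS](@big_cat_nat _ _ _ H) //= leq_addr.
Qed.

(** The good events decrease with the horizon and their probabilities have a common
    lower bound, inherited by the intersection.  There v is a candidate, among at
    most K. *)
Lemma source_estimator_success (K : nat) : (0 < K)%N ->
  ((K%:R^-1 * (1 - (1 - B^-1) / (1 - theta) - (B - 1) / (theta ^+ 2 * K%:R)))%:E <=
   success_prob (source_estimator d theta) P (v : lattice d))%E.
Proof.
move=> K0; set g := 1 - _ - _.
pose E H := path_event v (H + H) (fun x => good theta K x H).
have pg H := @pattern_good R theta K _ H : pattern_fun (H + H) (fun x : nat -> 'rV[int]_d => good theta K x H).
have mE H : measurable (E H) by exact: measurable_path_event.
have mcap : measurable (\bigcap_H E H) by apply: countable_bigcap_measurable.
have gE H : (g%:E <= P (E H))%E.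
  by rewrite (path_event_prob srwP (pg H)) lee_fin; exact: good_prob.
have gcap : (g%:E <= P (\bigcap_H E H))%E.
  have cv : P \o E @ \oo --> P (\bigcap_H E H).
    apply: nonincreasing_cvg_mu => //.
      by rewrite (le_lt_trans (probability_le1 _ _)) ?ltry.
    move=> H H' HH; apply/subsetPset; apply: path_event_prefix => //; first by lia.
    by move=> x; exact: good_anti.
  rewrite -(cvg_lim _ cv) //; apply: lime_ge; first by apply/cvg_ex; eexists; exact: cv.
  by apply: nearW => H; exact: gE.
have hcap w : (\bigcap_H E H) w ->
    ((K%:R^-1)%:E <= source_estimator d theta (walk_trace w) [set (v : lattice d)])%E.
  move=> hw.
  have hH H := path_eventP (pg H) (hw H I).
  have w0 : w 0%N = v by have [] := hH 0%N.
  have wadj n : lattice_adj (w n) (w n.+1) by have [_ h _] := hH n.+1; apply: h; lia.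
  have wg H : good theta K w H by have [] := hH H.
  apply: source_estimator_ge => //.
    rewrite -w0; exact: (source_like_start theta0 wg).
  move=> s us hs; exact: (source_like_few theta0 wadj wg us hs).
rewrite /success_prob.
have mf : measurable_fun [set: trajectory d] (fun w => source_estimator d theta (walk_trace w) [set (v : lattice d)]).
  apply: (measurableT_comp (measurable_kernel (source_estimator d theta) [set (v : lattice d)] _)) => //.
  exact: measurable_walk_trace.
apply: (@le_trans _ _ (\int[P]_(w in \bigcap_H E H) (K%:R^-1)%:E)%E).
  rewrite integral_cst // EFinM; apply: lee_wpmul2l gcap.
  by rewrite lee_fin invr_ge0 ler0n.
apply: (@le_trans _ _ (\int[P]_(w in \bigcap_H E H) source_estimator d theta (walk_trace w) [set (v : lattice d)])%E).
  apply: ge0_le_integral => //; exact: measurable_funS mf.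
by apply: ge0_subset_integral => //.
Qed.

End Success.

(** * First-step decomposition of the law of the walk *)

Section Prepend.
Variable d : nat.
Notation step := ('I_d * bool)%type.

Definition prepend (a : 'rV[int]_d) (w : trajectory d) : trajectory d :=
  fun n => if n is k.+1 then w k else a.

Lemma measurable_prepend (a : 'rV[int]_d) : measurable_fun [set: trajectory d] (prepend a).
Proof.
apply: (@measurability _ _ (trajectory d) (trajectory d) setT (prepend a)
  (@coordinate_events d)) => //.
move=> _ [_ [n [x ->]] <-]; rewrite setTI.
case: n => [|n]; last exact: measurable_coordinate.
case: (eqVneq a x) => [->|ax].
  by rewrite (_ : _ @^-1` _ = setT) //; apply/seteqP; split.
rewrite (_ : _ @^-1` _ = set0) //; apply/seteqP; split => // w /= e.
by move/eqP: ax.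
Qed.

Variables (R : realType) (P : 'rV[int]_d -> probability (trajectory d) R).
Hypothesis d0 : (0 < d)%N.
Hypothesis srwP : forall v : 'rV[int]_d, is_srw_law (v : lattice d) (P v).

Definition prepend_law (a b : 'rV[int]_d) : {measure set (trajectory d) -> \bar R}.
Proof. by refine (pushforward (P b) (prepend a)); exact: measurable_prepend. Defined.

Let c : {nonneg R} := ((2 * d)%:R^-1)%:nng.

(** The steps are listed by [index_enum] because finite sums of measures are
    indexed by natural numbers. *)
Definition first_step_law (s0 : step) (u : 'rV[int]_d) : {measure set (trajectory d) -> \bar R} :=
  msum (fun n => mscale c (prepend_law u (u + stepv (nth s0 (index_enum (step : finType)) n))))
    (size (index_enum (step : finType))).

Lemma first_step_lawE s0 u A :
  first_step_law s0 u A = (\sum_(s : step) ((2 * d)%:R^-1)%:E * P (u + stepv s) (prepend u @^-1` A))%E.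
Proof. by rewrite /first_step_law /= /msum /= [RHS](big_nth s0) big_mkord. Qed.

(** A pi-system that generates the events on trajectories.  Starting the
    cylinders at length 2 leaves out the paths without a first step. *)
Definition cylinders : set (set (trajectory d)) :=
  [set A | A = set0 \/ A = setT \/ exists (n : nat) (x : nat -> 'rV[int]_d),
     A = [set w : trajectory d | forall i, (i <= n.+1)%N -> w i = x i]].

Lemma cylinders_setI_closed : setI_closed cylinders.
Proof.
have cylI n x m y : (n <= m)%N -> cylinders
   ([set w : trajectory d | forall i, (i <= n.+1)%N -> w i = x i] `&`
    [set w : trajectory d | forall i, (i <= m.+1)%N -> w i = y i]).
  move=> nm; case: (pselect (forall i, (i <= n.+1)%N -> x i = y i)) => h.
    right; right; exists m, y; apply/seteqP; split => [w []//|w hw]; split => // i hi.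
    by rewrite h // hw //; lia.
  left; apply/seteqP; split => // w [h1 h2]; apply: h => i hi.
  by rewrite -h1 // h2 //; lia.
move=> A B [->|[->|[n [x ->]]]] [->|[->|[m [y ->]]]]; rewrite ?set0I ?setI0 ?setTI ?setIT;
  try by [left|right; left|right; right; exists n, x|right; right; exists m, y].
by case: (leqP n m) => [/cylI//|/ltnW/cylI]; rewrite setIC.
Qed.

Lemma measurable_cylinders A : cylinders A -> measurable A.
Proof. by case=> [->|[->|[n [x ->]]]] //; exact: measurable_cylinder_path. Qed.

Lemma generated_cylinders : measurable = <<s cylinders >> :> set (set (trajectory d)).
Proof.
apply/seteqP; split; last first.
  apply: smallest_sub; first exact: sigma_algebra_measurable.
  exact: measurable_cylinders.
apply: smallest_sub; first exact: smallest_sigma_algebra.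
move=> _ [n [x ->]].
pose T := g_sigma_algebraType cylinders.
rewrite (_ : mkset _ = \bigcup_(l : seq 'rV[int]_d)
   [set w : trajectory d | nth 0 l n = x /\ forall i, (i <= n.+1)%N -> w i = nth 0 l i]).
  apply: (@countable_bigcup_measurable _ T) => l.
  apply: (@measurable_if_prop _ T) => e.
  by apply: sub_sigma_algebra; right; right; exists n, (nth 0 l).
apply/seteqP; split => [w /= e|w [l _ /= [<- h]]]; last by rewrite h.
exists (mkseq w n.+2) => //=.
rewrite -[LHS]/(nth 0 (mkseq w n.+2) n) nth_mkseq // e; split => // i hi.
by rewrite -[RHS]/(nth 0 (mkseq w n.+2) i) nth_mkseq.
Qed.

Lemma sum_steps_const : (\sum_(s : step) ((2 * d)%:R^-1)%:E = 1 :> \bar R)%E.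
Proof.
rewrite sumEFin sumr_const card_prod card_ord card_bool mulnC -[_ *+ _]mulr_natr mulVf //.
by rewrite pnatr_eq0; lia.
Qed.

(** Both measures agree on cylinders: a path from x0 = u has positive mass only if
    x1 is a neighbour of u, and then exactly one step leads there. *)
Lemma first_step_law_eq s0 u A : measurable A -> P u A = first_step_law s0 u A.
Proof.
have PT v : P v setT = 1%E by exact: probability_setT.
apply: (measure_unique cylinders (fun=> setT)).
- exact: generated_cylinders.
- exact: cylinders_setI_closed.
- by move=> _; right; left.
- by rewrite bigcup_const //; exists 0%N.
- move=> _ [->|[->|[n [x ->]]]]; rewrite first_step_lawE.
  + rewrite measure0 big1 // => s _.
    by rewrite preimage_set0 measure0 mule0.
  + apply: (eq_trans (PT u)); rewrite -[LHS]sum_steps_const; apply: eq_bigr => s _.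
    by rewrite preimage_setT PT mule1.
  apply: (eq_trans (srwP u n.+1 x)).
  pose adjs := [forall i : 'I_n, lattice_adj (x i.+1 : lattice d) (x i.+2)].
  have hs s : P (u + stepv s) (prepend u @^-1` [set w : trajectory d | forall i, (i <= n.+1)%N -> w i = x i]) =
     (if [&& x 0%N == u, x 1%N == u + stepv s & adjs] then ((2 * d)%:R ^- n)%:E else 0%E).
    case: (eqVneq (x 0%N) u) => [e|ne] /=.
      rewrite (_ : _ @^-1` _ = [set w : trajectory d | forall i, (i <= n)%N -> w i = x i.+1]).
        exact: (srwP (u + stepv s) n (fun i => x i.+1)).
      apply/seteqP; split => [w h i hi|w h [|i] hi]; [exact: (h i.+1) | by rewrite e | exact: h].
    rewrite (_ : _ @^-1` _ = set0) ?measure0 //.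
    by apply/seteqP; split => // w /(_ 0%N isT) /= e; move: ne; rewrite -e eqxx.
  under eq_bigr => s _ do rewrite hs.
  case: (eqVneq (x 0%N) u) => [e|ne] /=; last first.
    by rewrite big1 // => s _; rewrite mule0.
  have eadj : [forall i : 'I_n.+1, lattice_adj (x i : lattice d) (x i.+1)] =
      lattice_adj (x 0%N : lattice d) (x 1%N) && adjs.
    apply/forallP/andP => [h|[h1 /forallP h2] [[|i] hi]].
    - split; first exact: (h ord0).
      by apply/forallP => i; exact: (h (lift ord0 i)).
    - exact: h1.
    - exact: (h2 (Ordinal (hi : (i < n)%N))).
  rewrite eadj; case: (boolP adjs) => ha; last first.
    by rewrite andbF big1 // => s _; rewrite andbF mule0.
  rewrite andbT; case: (lattice_adjP (x 0%N) (x 1%N)) => [[s es]|nadj]; last first.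
    rewrite big1 // => s _; case: eqP => [es|_]; last by rewrite mule0.
    by exfalso; apply: nadj; exists s; rewrite e.
  rewrite (bigD1 s) //= big1 => [|s' ss']; last first.
    case: eqP => [es'|_]; last by rewrite mule0.
    move: es'; rewrite es e => /addrI/stepv_inj es'.
    by move: ss'; rewrite es' eqxx.
  by rewrite -e -es eqxx /= adde0 exprS invfM EFinM.
- by move=> _; apply: (le_lt_trans (probability_le1 (P u) _)); rewrite ?ltry.
Qed.

Lemma integral_first_step (u : 'rV[int]_d) (f : trajectory d -> \bar R) :
  measurable_fun [set: trajectory d] f -> (forall w, 0 <= f w)%E ->
  (\int[P u]_w f w = \sum_(s : step) ((2 * d)%:R^-1)%:E *
     \int[P (u + stepv s)]_w f (prepend u w))%E.
Proof.
move=> mf f0; pose s0 : step := (Ordinal d0, true).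
rewrite (eq_measure_integral (first_step_law s0 u)); last first.
  by move=> A mA _; exact: first_step_law_eq.
rewrite ge0_integral_measure_sum // [RHS](big_nth s0) big_mkord; apply: eq_bigr => n _.
rewrite ge0_integral_mscale //; congr (_ * _)%E.
rewrite ge0_integral_pushforward //; first exact: measurable_prepend.
Qed.
End Prepend.

(** * Upper bound for every estimator *)

Lemma subgraph_ext (d : nat) (G H : subgraph d) :
  vertices G = vertices H -> edges G = edges H -> G = H.
Proof.
case: G H => [V E p] [V' E' p'] /= eV eE; rewrite -eV -eE in p' *.
by congr Subgraph; exact: Prop_irrelevance.
Qed.

(** The only new edge joins v to u, and the walk from u crosses it at its first
    step. *)
Lemma trace_backtrack (d : nat) (v u : 'rV[int]_d) (w : trajectory d) :
  w 0%N = v -> lattice_adj (v : lattice d) u ->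
  walk_trace (prepend v (prepend u w)) = walk_trace (prepend u w).
Proof.
move=> w0 vu; apply: subgraph_ext => /=.
  apply/seteqP; split => [x [[|n] _ <-]|x [n _ <-]].
  - by exists 1%N => //=; rewrite w0.
  - by exists n.
  - by exists n.+1.
apply/seteqP; split => [e [[|n] [an ->]]|e [n [an ->]]].
- exists 0%N; rewrite /= w0 setUC; split => //.
  move: vu; rewrite /lattice_adj => /eqP <-; apply/eqP.
  by apply: eq_bigr => i _; rewrite distrC.
- by exists n.
- by exists n.+1.
Qed.

Lemma integral_le1 (disp : measure_display) (T : measurableType disp) (R : realType)
    (Q : probability T R) (f : T -> \bar R) :
  measurable_fun setT f -> (forall x, 0 <= f x <= 1)%E ->
  (0 <= \int[Q]_x f x <= 1)%E.
Proof.
move=> mf f01; apply/andP; split; first by apply: integral_ge0 => x _; case/andP: (f01 x).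
rewrite (_ : 1 = \int[Q]_x cst 1 x)%E; last first.
  by rewrite integral_cst // mul1e; apply/esym/probability_setT.
by apply: ge0_le_integral => // [x _|x _]; case/andP: (f01 x).
Qed.

Section UpperBound.
Variables (R : realType) (d : nat) (P : 'rV[int]_d -> probability (trajectory d) R).
Hypothesis d0 : (0 < d)%N.
Hypothesis srwP : forall v : 'rV[int]_d, is_srw_law (v : lattice d) (P v).
Variable Phi : estimator R d.
Notation step := ('I_d * bool)%type.

Let guess (x : 'rV[int]_d) (w : trajectory d) : \bar R :=
  Phi (walk_trace w) [set (x : lattice d)].

Let measurable_guess x : measurable_fun [set: trajectory d] (guess x).
Proof.
apply: (measurableT_comp (measurable_kernel Phi [set (x : lattice d)] _)) => //.
exact: measurable_walk_trace.
Qed.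

Let guess01 x w : (0 <= guess x w <= 1)%E.
Proof.
rewrite /guess measure_ge0 /= -(@prob_kernel _ _ _ _ _ Phi (walk_trace w)).
by apply: le_measure; rewrite ?inE.
Qed.

Let measurable_guess_prepend a x : measurable_fun [set: trajectory d] (guess x \o prepend a).
Proof. by apply: measurableT_comp; [exact: measurable_guess | exact: measurable_prepend]. Qed.

(** The law of the trace of a step from a to b followed by the walk from b occurs
    for the source a with weight 1/(2d), and, by [trace_backtrack], for the
    source b with weight 1/(4 d^2). *)
Definition edge_guess (a b x : 'rV[int]_d) : R :=
  fine (\int[P b]_w guess x (prepend a w)).

Lemma edge_guessE a b x : (\int[P b]_w guess x (prepend a w) = (edge_guess a b x)%:E)%E.
Proof.
have /andP[h0 h1] := integral_le1 (P b) (measurable_guess_prepend a x) (fun w => guess01 x (prepend a w)).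
by rewrite /edge_guess fineK // ge0_fin_numE // (le_lt_trans h1) // ltry.
Qed.

Lemma edge_guess_le1 a b x : edge_guess a b x <= 1.
Proof.
have /andP[h0 h1] := integral_le1 (P b) (measurable_guess_prepend a x) (fun w => guess01 x (prepend a w)).
by rewrite -lee_fin -edge_guessE.
Qed.

Lemma edge_guess_sum a b x y : x != y -> edge_guess a b x + edge_guess a b y <= 1.
Proof.
move=> xy; rewrite -lee_fin EFinD -!edge_guessE -ge0_integralD //.
- have : (0 <= \int[P b]_w (guess x (prepend a w) + guess y (prepend a w)) <= 1)%E.
    apply: integral_le1.
      by apply: emeasurable_funD; exact: measurable_guess_prepend.
    move=> w; rewrite adde_ge0 /=; [|by case/andP: (guess01 x (prepend a w))|by case/andP: (guess01 y (prepend a w))].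
    rewrite /guess -measureU //.
      rewrite -(@prob_kernel _ _ _ _ _ Phi (walk_trace (prepend a w))).
      by apply: le_measure; rewrite ?inE.
    by apply/seteqP; split => // z [/= -> e]; move: xy; rewrite e eqxx.
  by case/andP.
- exact: measurable_guess_prepend.
- exact: measurable_guess_prepend.
Qed.

Lemma success_first_step v :
  success_prob Phi (P v) (v : lattice d) =
  ((2 * d)%:R^-1 * \sum_(s : step) edge_guess v (v + stepv s) v)%:E.
Proof.
rewrite /success_prob (integral_first_step d0 srwP v (measurable_guess v)) => [|w]; last first.
  by case/andP: (guess01 v w).
rewrite mulr_sumr -sumEFin; apply: eq_bigr => s _.
by rewrite edge_guessE.
Qed.

Definition opp_step (s : step) : step := (s.1, ~~ s.2).

Lemma stepv_opp s : stepv (opp_step s) = - @stepv d s.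
Proof. by rewrite /stepv /=; case: s.2; rewrite ?scale1r ?scaleN1r ?opprK. Qed.

Lemma start_ae v : {ae P v, forall w : trajectory d, w 0%N = v}.
Proof.
have m0 : measurable [set w : trajectory d | w 0%N = v] by exact: measurable_coordinate.
exists (~` [set w : trajectory d | w 0%N = v]); split => //; first exact: measurableC.
apply: (eq_trans (probability_setC (P v) m0)).
have -> : [set w : trajectory d | w 0%N = v] = [set w : trajectory d | forall i, (i <= 0)%N -> w i = v].
  by apply/seteqP; split => [w e i|w h]; [rewrite leqn0 => /eqP -> | exact: h].
have -> : P v [set w : trajectory d | forall i, (i <= 0)%N -> w i = v] = 1%E.
  rewrite (srwP v 0 (fun=> v)) eqxx /= ifT ?expr0 ?invr1 //.
  by apply/forallP => -[].
by rewrite subee.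
Qed.

(** Among the second steps, the one back to v has weight 1/(2d) and produces the
    trace of a step from v + s to v; all the others are bounded by 1. *)
Lemma edge_guess_backtrack v (s : step) :
  edge_guess v (v + stepv s) v <=
  1 - (2 * d)%:R^-1 * (1 - edge_guess (v + stepv s) v v).
Proof.
set u := v + stepv s; set r := (2 * d)%:R^-1.
have r0 : 0 <= r by rewrite invr_ge0 ler0n.
have adj : lattice_adj (v : lattice d) u by apply/lattice_adjP; exists s.
have sr : \sum_(s' : step) r = 1 by have := sum_steps_const R d0; rewrite sumEFin => -[].
have eq1 : (edge_guess v u v)%:E = (\sum_(s' : step) r%:E *
    \int[P (u + stepv s')]_w guess v (prepend v (prepend u w)))%E.
  rewrite -edge_guessE (integral_first_step d0 srwP u (measurable_guess_prepend v v)) //.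
have uv : u + stepv (opp_step s) = v by rewrite stepv_opp addrK.
have eq2 : (\int[P (u + stepv (opp_step s))]_w guess v (prepend v (prepend u w)) =
    (edge_guess u v v)%:E)%E.
  rewrite uv -edge_guessE; apply: ge0_ae_eq_integral => //.
  - apply: (measurableT_comp (measurable_guess_prepend v v)).
    exact: measurable_prepend.
  - exact: measurable_guess_prepend.
  - apply: filterS (start_ae v) => w w0 _.
    by rewrite /guess trace_backtrack.
rewrite -lee_fin eq1 (bigD1 (opp_step s)) //= eq2.
have -> : 1 - r * (1 - edge_guess u v v) = r * edge_guess u v v + \sum_(s' | s' != opp_step s) r.
  by move: sr; rewrite (bigD1 (opp_step s)) //= => sr; rewrite -[X in X - _]sr; ring.
rewrite EFinD EFinM leeD2l // -sumEFin; apply: lee_sum => s' _.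
rewrite -[leRHS]mule1; apply: lee_wpmul2l; first by rewrite lee_fin.
have mf : measurable_fun [set: trajectory d] (fun w => guess v (prepend v (prepend u w))).
  apply: (measurableT_comp (measurable_guess_prepend v v)).
  exact: measurable_prepend.
have /andP[] // := integral_le1 (P (u + stepv s')) mf (fun w => guess01 v _).
Qed.

Notation cube := {ffun 'I_d -> bool}.

Definition corner (c : cube) : 'rV[int]_d := \row_j (c j : nat)%:Z.
Definition flip (c : cube) (i : 'I_d) : cube := [ffun j => c j (+) (j == i)].

Lemma flipK i : involutive (flip^~ i).
Proof. by move=> c; apply/ffunP => j; rewrite !ffunE -addbA addbb addbF. Qed.

Lemma corner_flip c i : corner (flip c i) = corner c + stepv (i, ~~ c i).
Proof.
apply/rowP => j; rewrite [RHS]mxE stepvE !mxE ffunE /=.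
by case: (eqVneq j i) => [->|_]; [case: (c i) | rewrite addbF addr0].
Qed.

Lemma flip_neq c i : corner c != corner (flip c i).
Proof.
rewrite corner_flip; apply/eqP => /rowP/(_ i) /eqP; rewrite mxE [X in _ == X]mxE stepvE eqxx mxE /=.
by case: (c i).
Qed.

(** At every corner of the cube, the failures across its d edges are at most
    2 d (1 - W) when the corner is the source a of [edge_guess], and
    (2 d)^2 (1 - W) when it is the source b.  Every ordered pair of adjacent
    corners is seen once in each role, and its two failures add up to at least 1.
    The cube is a finite set containing half of the neighbours of each of its
    points. *)
Lemma success_upper_bound (W : R) :
  (forall v : 'rV[int]_d, (W%:E <= success_prob Phi (P v) (v : lattice d))%E) ->
  1 <= (2 + 4 * d%:R) * (1 - W).
Proof.
move=> hW; set r : R := (2 * d)%:R^-1.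
have dp : 0 < d%:R :> R by rewrite ltr0n.
have r0 : 0 < r by rewrite invr_gt0 natrM mulr_gt0.
have r2d : r * (2 * d%:R) = 1 by rewrite /r natrM mulVf // mulf_neq0 // lt0r_neq0.
have r2d' : 2 * d%:R * r = 1 by rewrite mulrC.
have d2 : 0 <= 2 * d%:R :> R by rewrite mulr_ge0.
have sum1 : \sum_(s : step) 1 = 2 * d%:R :> R.
  by rewrite sumr_const card_prod card_ord card_bool mulnC natrM.
have h1 v : \sum_(s : step) (1 - edge_guess v (v + stepv s) v) <= 2 * d%:R * (1 - W).
  have := hW v; rewrite success_first_step lee_fin -/r => h.
  rewrite sumrB sum1 mulrBr mulr1 lerD2l lerN2.
  by have := ler_wpM2l d2 h; rewrite mulrA r2d' mul1r.
have h2 v : \sum_(s : step) (1 - edge_guess (v + stepv s) v v) <= (2 * d%:R) ^+ 2 * (1 - W).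
  have : r * \sum_(s : step) (1 - edge_guess (v + stepv s) v v) <=
      \sum_(s : step) (1 - edge_guess v (v + stepv s) v).
    rewrite mulr_sumr; apply: ler_sum => s _.
    by have := edge_guess_backtrack v s; rewrite -/r; lra.
  move=> /le_trans/(_ (h1 v)) h.
  by have := ler_wpM2l d2 h; rewrite [leLHS]mulrA r2d' mul1r [leRHS]mulrA -expr2.
pose far (x y : 'rV[int]_d) := 1 - edge_guess x y x.
pose near (x y : 'rV[int]_d) := 1 - edge_guess x y y.
have sub (F : step -> R) (c : cube) : (forall s, 0 <= F s) -> \sum_i F (i, ~~ c i) <= \sum_(s : step) F s.
  move=> F0.
  have -> : \sum_(s : step) F s = \sum_i \sum_(b : bool) F (i, b).
    by rewrite pair_bigA; apply: eq_bigr => -[].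
  apply: ler_sum => i _; rewrite big_bool /=.
  by case: (c i) => /=; rewrite ?lerDl ?lerDr.
have g1 c : \sum_i far (corner c) (corner (flip c i)) <= 2 * d%:R * (1 - W).
  apply: le_trans (h1 (corner c)); apply: le_trans (sub _ c _).
    by apply: ler_sum => i _; rewrite /far corner_flip.
  by move=> s; rewrite subr_ge0 edge_guess_le1.
have g2 c : \sum_i near (corner (flip c i)) (corner c) <= (2 * d%:R) ^+ 2 * (1 - W).
  apply: le_trans (h2 (corner c)).
  apply: le_trans (sub (fun s => 1 - edge_guess (corner c + stepv s) (corner c) (corner c)) c _).
    by apply: ler_sum => i _; rewrite /near corner_flip.
  by move=> s; rewrite subr_ge0 edge_guess_le1.
have tot : \sum_(c : cube) d%:R <= \sum_(c : cube) (2 * d%:R * (1 - W) + (2 * d%:R) ^+ 2 * (1 - W)) :> R.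
  apply: (@le_trans _ _ (\sum_(c : cube) (\sum_i far (corner c) (corner (flip c i)) +
      \sum_i near (corner (flip c i)) (corner c)))); last first.
    by apply: ler_sum => c _; apply: lerD.
  have -> : \sum_(c : cube) (\sum_i far (corner c) (corner (flip c i)) +
      \sum_i near (corner (flip c i)) (corner c)) =
      \sum_(c : cube) \sum_i (far (corner c) (corner (flip c i)) + near (corner c) (corner (flip c i))).
    rewrite big_split /= [X in _ + X = _]exchange_big /=.
    under [X in _ + X = _]eq_bigr => i _ do rewrite (reindex_inj (inv_inj (flipK i))) /=.
    rewrite [X in _ + X = _]exchange_big -big_split; apply: eq_bigr => c _.
    by rewrite -big_split; apply: eq_bigr => i _; rewrite flipK.
  apply: ler_sum => c _; rewrite -[X in X%:R]card_ord -sumr_const; apply: ler_sum => i _.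
  have := edge_guess_sum (corner c) (corner (flip c i)) (flip_neq c i).
  by rewrite /far /near; lra.
move: tot; rewrite !sumr_const lerMn2r => /orP[/eqP|h].
  by rewrite card_ffun card_bool => /eqP; rewrite expn_eq0.
by rewrite -(ler_pM2l dp) mulr1; apply: le_trans h _; apply: le_of_eq; ring.
Qed.

End UpperBound.

(** * Choice of the density of cut times *)

Lemma success_constant_eq (R : realFieldType) (B : R) : 1 <= B ->
  1 - (1 - B^-1) / (1 - (2 * B)^-1) = (2 * B - 1)^-1.
Proof.
move=> B1; have B0 : B != 0 by rewrite lt0r_neq0 // (lt_le_trans ltr01).
have B2 : 2 * B - 1 != 0 by rewrite lt0r_neq0 //; lra.
by field; rewrite B0 B2.
Qed.

(** The choice theta = 1 / (2B) makes the density of cut times that is asked for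
    half of the guaranteed mean density 1 / B. *)
Lemma source_estimator_worst (R : realType) (d : nat)
    (P : lattice d -> probability (trajectory d) R) (B : R) (K : nat) :
  (0 < d)%N -> (forall v, is_srw_law v (P v)) ->
  (forall M, green R d M <= B) -> (0 < K)%N ->
  ((K%:R^-1 * ((2 * B - 1)^-1 - 4 * B ^+ 2 * (B - 1) / K%:R))%:E <=
   worst_success_prob (source_estimator d (2 * B)^-1) P)%E.
Proof.
move=> d0 srwP greenB K0; have B1 := green_bound_ge1 greenB.
have Bp : 0 < B by apply: lt_le_trans B1.
have t0 : 0 < (2 * B)^-1 by rewrite invr_gt0 mulr_gt0.
have t1 : (2 * B)^-1 < 1 by rewrite invf_lt1 ?mulr_gt0 //; lra.
apply: le_ereal_inf_tmp => _ [v _ <-].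
have := source_estimator_success d0 (srwP v) greenB t0 t1 K0.
rewrite success_constant_eq //; apply: le_trans; rewrite lee_fin.
have K0' : 0 < K%:R :> R by rewrite ltr0n.
apply: le_of_eq; congr (_ * (_ - _)); field.
by rewrite !lt0r_neq0.
Qed.

Theorem theorem1p5 (R : realType)
    (P : forall d : nat, lattice d -> probability (trajectory d) R)
    (hP : forall (d : nat) (v : lattice d), (0 < d)%N -> is_srw_law v (P d v)) :
  (exists Gamma : forall d : nat, estimator R d,
     (forall d : nat, (5 <= d)%N ->
        (0 < worst_success_prob (Gamma d) (P d))%E) /\
     (exists (C : R) (d0 : nat), 0 < C /\
        forall d : nat, (d0 <= d)%N ->
          ((1 - C / d%:R)%:E <= worst_success_prob (Gamma d) (P d))%E)) /\
  (exists (c : R) (d0 : nat), 0 < c /\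
     forall d : nat, (d0 <= d)%N ->
       forall Phi : estimator R d,
         (worst_success_prob Phi (P d) <= (1 - c / d%:R)%:E)%E).
Proof.
split; last first.
  (* A success of 1 - 1/(7d) would give 1 <= 2/(7d) + 4/7. *)
  exists (1 / 7), 1%N; split; first lra.
  move=> d d0 Phi; have dp : 0 < d%:R :> R by rewrite ltr0n.
  have d1 : 1 <= d%:R :> R by rewrite ler1n.
  rewrite leNgt; apply/negP => h.
  have hW v : ((1 - 1 / 7 / d%:R)%:E <= success_prob Phi (P d v) v)%E.
    by apply: le_trans (ltW h) _; apply: ereal_inf_lbound; exists v.
  have := success_upper_bound d0 (fun v => hP d v d0) hW.
  have -> : (2 + 4 * d%:R) * (1 - (1 - 1 / 7 / d%:R)) = (2 / 7) / d%:R + 4 / 7 :> R.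
    by field; exact: lt0r_neq0.
  have : (2 / 7) / d%:R <= 2 / 7 :> R by rewrite ler_pdivrMr // ler_peMr //; lra.
  by lra.
have hex (d : nat) : exists B : R, (5 <= d)%N ->
    (forall M, green R d M <= B) /\ ((30 <= d)%N -> B = 1 + 18 / d%:R).
  have [d30|d30] := leqP 30 d.
    by exists (1 + 18 / d%:R) => _; split => // M; exact: green_large.
  case: (leqP 5 d) => d5; last by exists 0.
  by have [B hB] := green_finite R d5; exists B.
have [Bf hB] := choice hex.
exists (fun d => source_estimator d (2 * Bf d)^-1); split => [d d5|].
  have d0 : (0 < d)%N by apply: leq_trans d5.
  have [hB1 _] := hB d d5; have B1 := green_bound_ge1 hB1.
  set B := Bf d in hB1 B1 *.
  have g0 : 0 < (2 * B - 1)^-1 by rewrite invr_gt0; lra.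
  pose K := (Num.truncn (4 * B ^+ 2 * (B - 1) / (2 * B - 1)^-1)).+1.
  have hK : 4 * B ^+ 2 * (B - 1) / (2 * B - 1)^-1 < K%:R by exact: truncnS_gt.
  have K0 : 0 < K%:R :> R by rewrite ltr0n.
  apply: lt_le_trans (source_estimator_worst d0 (fun v => hP d v d0) hB1 (ltn0Sn _ : (0 < K)%N)).
  rewrite lte_fin mulr_gt0 ?invr_gt0 // subr_gt0 ltr_pdivrMr //.
  by rewrite [ltRHS]mulrC -ltr_pdivrMr.
(* With B = 1 + t, t = 18/d <= 3/5 and K = 1, the bound is at least
   1 - 2t - 16t. *)
exists 324, 30%N; split; [by rewrite ltr0n | move=> d d30].
have d5 : (5 <= d)%N by apply: leq_trans d30.
have d0 : (0 < d)%N by apply: leq_trans d30.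
have [hB1 /(_ d30) eB] := hB d d5.
apply: le_trans (source_estimator_worst d0 (fun v => hP d v d0) hB1 (ltnSn 0)).
rewrite lee_fin invr1 mul1r mulr1 eB.
have dp : 0 < d%:R :> R by rewrite ltr0n.
have -> : 324 / d%:R = 18 * (18 / d%:R) :> R by ring.
have t0 : 0 <= 18 / d%:R :> R by rewrite divr_ge0 // ltW.
have t1 : 18 / d%:R <= 3 / 5 :> R.
  have : 30 <= d%:R :> R by rewrite (ler_nat R 30 d).
  by rewrite ler_pdivrMr //; lra.
move: (18 / d%:R) t0 t1 => t t0 t1.
have -> : 2 * (1 + t) - 1 = 1 + 2 * t by ring.
have -> : 1 + t - 1 = t by ring.
have h1 : 1 - 2 * t <= (1 + 2 * t)^-1.
  rewrite -[leRHS]mul1r ler_pdivlMr; last by lra.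
  have -> : (1 - 2 * t) * (1 + 2 * t) = 1 - (2 * t) ^+ 2 by ring.
  by rewrite gerBl sqr_ge0.
have h2 : 4 * (1 + t) ^+ 2 * t <= 16 * t.
  apply: ler_wpM2r => //.
  have : (1 + t) ^+ 2 <= 2 ^+ 2 by apply: lerXn2r; rewrite ?nnegrE; lra.
  by lra.
lra.
Qed.
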